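(* Let $\Phi$ be a homogeneous Poisson point process on $\mathbb{R}^2$ with intensity $\lambda>0$, and let $\Phi^{(2)}$ be the point process of atoms of $\Phi$ that are in mutually nearest neighbour relation with some other atom of $\Phi$. Let $\mathbb{P}^{(2),x}$ denote the Palm probability of $\Phi^{(2)}$ at $x\in\mathbb{R}^2$. Then the nearest neighbour distribution function of $\Phi^{(2)}$ is, for all $r\ge 0$, $$G^{(2)}(r) := \mathbb{P}^{(2),x}\big(d(x,\Phi^{(2)}\setminus \{x\})\leq r\big) = 1-e^{-\lambda\pi r^2 (2-\gamma)},$$ where $\gamma := \frac{2}{3}-\frac{\sqrt{3}}{2\pi}$ and $d(x,B)=\inf_{z\in B}|x-z|$.
   Context: For a locally finite point configuration $\phi\subset\mathbb{R}^2$ and distinct atoms $x,y\in\phi$, write $x\overset{\phi}{\rightarrow} y$ if $y$ is the (a.s. unique) nearest neighbour of $x$ in $\phi\setminus\{x\}$. Atoms $x,y$ are in mutually nearest neighbour relation (MNNR) if $x\overset{\phi}{\rightarrow} y$ and $y\overset{\phi}{\rightarrow} x$. $\Phi^{(2)}$ is the dependent thinning $\{x\in\Phi: x \text{ is in MNNR with some } y\in\Phi\setminus\{x\}\}$; it is stationary. *)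

(* Defs.v *)
From HB Require Import structures.
From mathcomp Require Import all_boot all_order all_algebra.
From mathcomp Require Import all_classical all_reals all_analysis.
Set Implicit Arguments. Unset Strict Implicit. Unset Printing Implicit Defensive.
Import Order.TTheory GRing.Theory Num.Theory.
Local Open Scope classical_set_scope.
Local Open Scope ring_scope.

Section Defs.
Variable R : realType.
Local Notation pt := (R * R)%type.

Definition edist (x y : pt) : R :=
  Num.sqrt ((x.1 - y.1) ^+ 2 + (x.2 - y.2) ^+ 2).

Definition padd (x y : pt) : pt := (x.1 + y.1, x.2 + y.2).
Definition psub (x y : pt) : pt := (x.1 - y.1, x.2 - y.2).

Definition bounded_set (B : set pt) : Prop :=
  exists M : R, forall z, B z -> edist (0, 0) z <= M.

Definition locally_finite (phi : set pt) : Prop :=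
  forall B, bounded_set B -> finite_set (phi `&` B).

Definition cnt (phi : set pt) (B : set pt) : \bar R :=
  (\esum_(y in phi `&` B) (1 : \bar R))%E.

Definition leb2 : set pt -> \bar R :=
  (@lebesgue_measure R \x @lebesgue_measure R)%E.

Definition poisson_mass (m : R) (n : nat) : R :=
  expR (- m) * m ^+ n / (n`!)%:R.

(* homogeneous Poisson point process on R^2 with intensity lam,
   given by its finite-dimensional distributions *)
Definition is_poisson_pp (d : measure_display) (Omega : measurableType d)
  (P : probability Omega R) (Phi : Omega -> set pt) (lam : R) : Prop :=
  [/\ forall w, locally_finite (Phi w),
      forall B (n : nat), measurable B -> bounded_set B ->
        measurable [set w | cnt (Phi w) B = (n%:R)%:E] &
      forall (k : nat) (B : 'I_k -> set pt) (n : 'I_k -> nat),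
        (forall i, measurable (B i) /\ bounded_set (B i)) ->
        (forall i j, i != j -> B i `&` B j = set0) ->
        P (\bigcap_(i in [set: 'I_k]) [set w | cnt (Phi w) (B i) = ((n i)%:R)%:E])
        = (\prod_(i < k) poisson_mass (lam * fine (leb2 (B i))) (n i))%:E].

Definition nn (phi : set pt) (x y : pt) : Prop :=
  phi y /\ y <> x /\
  forall z, phi z -> z <> x -> z <> y -> edist x y < edist x z.

Definition mnnr (phi : set pt) (x y : pt) : Prop :=
  phi x /\ phi y /\ nn phi x y /\ nn phi y x.

Definition thin2 (phi : set pt) : set pt :=
  [set x | phi x /\ exists y, y <> x /\ mnnr phi x y].

(* d(x,B) = inf_{z in B} |x - z|  (= +oo for empty B) *)
Definition dist_set (x : pt) (B : set pt) : \bar R :=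
  ereal_inf [set (edist x z)%:E | z in B].

Definition shift (phi : set pt) (v : pt) : set pt := [set padd z v | z in phi].

Definition unit_square : set pt :=
  [set z | 0 <= z.1 <= 1 /\ 0 <= z.2 <= 1].

(* Palm probability at x of a stationary point process Psi, evaluated on an
   event F of configurations (Mecke / Campbell definition, with the unit
   square as reference window):
   P^x(F) = E[ #{y in Psi cap [0,1]^2 : F(Psi - y + x)} ] / E[ #(Psi cap [0,1]^2) ] *)
Definition palm (d : measure_display) (Omega : measurableType d)
  (P : probability Omega R) (Psi : Omega -> set pt) (x : pt)
  (F : set pt -> Prop) : R :=
  fine (\int[P]_w cnt [set y | Psi w y /\ F (shift (Psi w) (psub x y))] unit_square)%E
  / fine (\int[P]_w cnt (Psi w) unit_square)%E.

Definition gamma_mnn : R := 2 / 3 - Num.sqrt 3 / (2 * pi).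

End Defs.

(* Main.v *)
From Pilot Require Import Defs.
From HB Require Import structures.
From mathcomp Require Import all_boot all_order all_algebra.
From mathcomp Require Import all_classical all_reals all_analysis.
From mathcomp Require Import measurable_realfun ring lra.
Set Implicit Arguments. Unset Strict Implicit. Unset Printing Implicit Defensive.
Import Order.TTheory GRing.Theory Num.Theory.
Import numFieldNormedType.Exports.
Local Open Scope classical_set_scope.
Local Open Scope ring_scope.
Import Pilot.Defs.

(* Within the thinned process the nearest neighbour of an atom is its partner, so
   the theorem asks for the mean number of atoms of the unit square whose partner
   lies at distance at most [r], relative to the mean number of all atoms of the
   thinned process there.  Two atoms [x, y] are partners iff the union of the two
   discs of radius [|x - y|] around them contains no other atom; this union has
   area [mnn_area * |x - y|^2] with [mnn_area = pi * (2 - gamma)].  Hence the mean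
   number of atoms with partner at distance in [(s, t]] is the integral of
   [lam ^ 2 * 2 pi u * exp (- lam * mnn_area * u^2)] over [(s, t]].

   Instead of the Mecke formula, the plane is cut into small cells: for cells [Q]
   and [p], the event that each holds exactly one atom and that a slightly
   shrunken (resp. enlarged) union of two discs holds no further one has an
   explicit probability, and the sums of these bound the mean from above (resp.
   below).  The bounds for one interval [(s, t]] agree up to second order in
   [t^2 - s^2], so subdividing the interval makes them exact. *)

(** * Invariance of the planar Lebesgue measure *)

Section Slides.
Variable R : realType.
Local Notation pt := (R * R)%type.
Local Notation leb := (@lebesgue_measure R).

(** The pushforward under [y + c] agrees with Lebesgue measure on half-open intervals, and these
    determine the measure. *)
Lemma lebesgue_measure_translate (c : R) (A : set R) : measurable A ->
  leb [set y | A (y + c)] = leb A.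
Proof.
move=> mA.
have mf : measurable_fun [set: R] (fun y : R => y + c).
  exact: (@measurable_funD _ _ _ _ (fun y => y) (fun=> c)).
rewrite [RHS](@lebesgue_measure_unique R
  (@measure_function_pushforward__canonical__measure_function_Measure
     _ _ (measurableTypeR R) (measurableTypeR R) R leb (fun y => y + c) mf)) //.
move=> X [[a b] _ <-].
rewrite /= /pushforward /= (_ : _ @^-1` _ = `]a - c, b - c]%classic); last first.
  by apply/seteqP; split => y; rewrite /= !in_itv /= ltrBlDr lerBrDr.
rewrite !lebesgue_measure_itv /= !lte_fin ltrD2r -!EFinD.
by case: ifP => // _; congr (_%:E); ring.
Qed.
Lemma measurable_preimageT d1 d2 (T1 : measurableType d1) (T2 : measurableType d2)
  (f : T1 -> T2) (A : set T2) :
  measurable_fun [set: T1] f -> measurable A -> measurable [set x | A (f x)].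
Proof. by move=> mf mA; rewrite -[X in measurable X]setTI; exact: mf. Qed.

Lemma measurable_affine (a b c : R) :
  measurable_fun [set: pt] (fun z : pt => a * z.1 + b * z.2 + c).
Proof.
by apply: measurable_funD => //; apply: measurable_funD; apply: measurable_funM.
Qed.

Lemma leb2E (A : set pt) : leb2 A = (\int[leb]_x leb (xsection A x))%E.
Proof. by []. Qed.

(** Both iterated integrals are measures with the product values on rectangles, hence equal. *)
Lemma leb2E_ysection (A : set pt) : measurable A ->
  leb2 A = (\int[leb]_y leb (ysection A y))%E.
Proof.
move=> mA; apply: (@product_measure_unique _ _ _ _ R leb leb
  (product_measure2 leb leb : {measure set _ -> \bar R})) => // B C mB mC.
exact: product_measure2E.
Qed.

(** Cavalieri's principle: a shear moves every section by a constant, and translations preserve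
    length. *)
Lemma leb2_shear2 (k c : R) (A : set pt) : measurable A ->
  leb2 [set z | A (z.1, z.2 + (k * z.1 + c))] = leb2 A.
Proof.
move=> mA; rewrite !leb2E; apply: eq_integral => x _.
rewrite -[RHS](@lebesgue_measure_translate (k * x + c)); last exact: measurable_xsection.
congr (leb _); apply/seteqP; split => y /=; by rewrite /xsection /= !inE.
Qed.

Lemma measurable_shear1 (k c : R) (A : set pt) : measurable A ->
  measurable [set z : pt | A (z.1 + (k * z.2 + c), z.2)].
Proof.
apply: measurable_preimageT; apply: measurable_fun_pair; last exact: measurable_snd.
have := measurable_affine 1 k c.
by under [X in measurable_fun _ X -> _]eq_fun do rewrite mul1r -addrA.
Qed.

Lemma measurable_shear2 (k c : R) (A : set pt) : measurable A ->
  measurable [set z : pt | A (z.1, z.2 + (k * z.1 + c))].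
Proof.
apply: measurable_preimageT; apply: measurable_fun_pair; first exact: measurable_fst.
have := measurable_affine k 1 c.
by under [X in measurable_fun _ X -> _]eq_fun do
  rewrite mul1r -addrA addrCA.
Qed.

Lemma leb2_shear1 (k c : R) (A : set pt) : measurable A ->
  leb2 [set z | A (z.1 + (k * z.2 + c), z.2)] = leb2 A.
Proof.
move=> mA; rewrite !leb2E_ysection//; last exact: measurable_shear1.
apply: eq_integral => y _.
rewrite -[RHS](@lebesgue_measure_translate (k * y + c)); last exact: measurable_ysection.
by congr (leb _); apply/seteqP; split => x /=; rewrite /ysection /= !inE.
Qed.

(* A rotation other than the half-turn is a product of three shears. *)
Lemma leb2_rotation (c s p q : R) (A : set pt) : c ^+ 2 + s ^+ 2 = 1 -> c != -1 ->
  measurable A ->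
  leb2 [set z | A (c * z.1 + s * z.2 + p, - s * z.1 + c * z.2 + q)] = leb2 A.
Proof.
move=> cs cN1 mA.
have c1 : 1 + c != 0 by rewrite addrC addr_eq0.
(* The tangent of half the angle, which is why the half-turn is excluded. *)
set a := s / (1 + c).
have sa : 1 - s * a = c.
  have s2 : s ^+ 2 = 1 - c ^+ 2 by rewrite -cs; ring.
  apply: (mulfI c1); rewrite /a; transitivity (1 + c - s ^+ 2); first by field.
  by rewrite s2; ring.
have ac : a * (1 + c) = s by rewrite /a divfK.
(* The term [- a * q] cancels what the shift [q] of the middle shear adds to the first
   coordinate. *)
rewrite -(@leb2_shear1 a (p - a * q) A mA).
have m2 := measurable_shear1 a (p - a * q) mA.
rewrite -(@leb2_shear2 (- s) q _ m2).
have m1 := measurable_shear2 (- s) q m2.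
rewrite -(@leb2_shear1 a 0 _ m1).
congr leb2; apply/funext => z /=; congr (A (_, _)).
  transitivity ((1 - s * a) * z.1 + a * (1 + (1 - s * a)) * z.2 + p); last by ring.
  by rewrite sa ac.
transitivity (- s * z.1 + (1 - s * a) * z.2 + q); last by ring.
by rewrite sa.
Qed.
End Slides.

(** * Areas of discs and of unions of two discs *)

Section CircularSegments.
Variable R : realType.
Local Notation pt := (R * R)%type.
Local Notation leb := (@lebesgue_measure R).

(** The triple angle formula gives [4 * x ^+ 3 - 3 * x = 0] for this cosine [x], and positivity
    selects the root. *)
Lemma cos_pi6 : cos (pi / 6) = Num.sqrt 3 / 2 :> R.
Proof.
have p0 := pi_gt0 R.
have c0 : 0 < cos (pi / 6 : R) by apply: cos_gt0_pihalf; lra.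
have : cos (pi / 6 + (pi / 6 + pi / 6)) = 0 :> R.
  by rewrite -(cos_pihalf R); congr cos; field.
rewrite !(cosD, sinD) => h.
have cs := cos2Dsin2 (pi / 6 : R).
have h4 : cos (pi / 6 : R) * (4 * cos (pi / 6) ^+ 2 - 3) = 0.
  rewrite -h; have -> : 3 = 3 * (cos (pi / 6) ^+ 2 + sin (pi / 6) ^+ 2) :> R.
    by rewrite cs mulr1.
  by ring.
have {h4} h5 : cos (pi / 6 : R) ^+ 2 = 3 / 4.
  by move/eqP: h4; rewrite mulf_eq0 gt_eqF //= => /eqP; lra.
rewrite -[LHS]ger0_norm ?(ltW c0) // -sqrtr_sqr h5 sqrtrM //.
by congr (_ * _); rewrite sqrtrV // (_ : 4 = 2 ^+ 2) ?sqrtr_sqr ?ger0_norm //; ring.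
Qed.

Lemma sin_pi6 : sin (pi / 6) = 1 / 2 :> R.
Proof.
have p0 := pi_gt0 R.
have s0 : 0 < sin (pi / 6 : R) by apply: sin_gt0_pihalf; lra.
have := cos2Dsin2 (pi / 6 : R).
rewrite cos_pi6 expr_div_n sqr_sqrtr // => h.
have : (sin (pi / 6 : R) - 1 / 2) * (sin (pi / 6) + 1 / 2) = 0 by lra.
by move/eqP; rewrite mulf_eq0 => /orP[] /eqP; lra.
Qed.

Lemma lebesgue_measure_sqr_le (g : R) :
  leb [set y : R | y ^+ 2 <= g] = (2 * Num.sqrt g)%:E.
Proof.
(* For negative [g] the set is empty and [Num.sqrt g] is 0 by convention. *)
have [g0|g0] := leP 0 g; last first.
  rewrite ler0_sqrtr ?(ltW g0) // mulr0.
  rewrite (_ : [set _ | _] = set0) ?measure0 //.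
  apply/seteqP; split => y //= yg.
  by have := le_trans (sqr_ge0 y) yg; rewrite leNgt g0.
rewrite (_ : [set _ | _] = `[- Num.sqrt g, Num.sqrt g]%classic); last first.
  apply/seteqP; split => y /=; rewrite in_itv /= -ler_norml.
    by move=> yg; rewrite -sqrtr_sqr ler_wsqrtr.
  by move=> h; rewrite -(sqr_sqrtr g0) -real_normK ?num_real // lerXn2r ?nnegrE ?sqrtr_ge0.
rewrite lebesgue_measure_itv /= lte_fin -EFinD.
have := sqrtr_ge0 g; case: ltP => h1 h2; congr (_%:E); lra.
Qed.

Lemma measurable_under_graph (a b : R) (g : R -> R) :
  measurable_fun [set: R] g ->
  measurable [set z : pt | a <= z.1 <= b /\ z.2 ^+ 2 <= g z.1].
Proof.
move=> mg.
have -> : [set z : pt | a <= z.1 <= b /\ z.2 ^+ 2 <= g z.1] =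
   [set z : pt | `[a, b]%classic z.1] `&` [set z : pt | z.2 ^+ 2 <= g z.1].
  by apply/seteqP; split => z /=; rewrite in_itv.
apply: measurableI.
  by apply: (measurable_preimageT (f := fst)) => //; exact: measurable_fst.
have := @measurable_fun_ler _ _ R setT (fun z : pt => z.2 ^+ 2) (fun z : pt => g z.1).
move=> /(_ _ _)/(_ measurableT [set true]); rewrite setTI => h.
apply: (h _ _ _) => //.
- exact: measurable_funX.
- exact: measurableT_comp.
Qed.

Lemma leb2_under_graph (a b : R) (g : R -> R) : measurable_fun [set: R] g ->
  leb2 [set z : pt | a <= z.1 <= b /\ z.2 ^+ 2 <= g z.1]
  = (\int[leb]_(x in `[a, b]) (2 * Num.sqrt (g x))%:E)%E.
Proof.
move=> mg; rewrite leb2E [RHS]integral_mkcond; apply: eq_integral => x _.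
rewrite patchE; case: ifPn; rewrite ?(inE, notin_setE) /= in_itv /= => hx.
  rewrite -lebesgue_measure_sqr_le; congr (leb _).
  by apply/seteqP; split => y; rewrite /xsection /= inE /= ?hx => -[] //.
rewrite (_ : xsection _ _ = set0) ?measure0 //.
by apply/seteqP; split => y //; rewrite /xsection /= inE /= => -[].
Qed.

Lemma continuous_derivable_oo (F : R -> R) (a b : R) :
  (forall x, derivable F x 1) -> derivable_oo_LRcontinuous F a b.
Proof.
move=> dF; have cF x : {for x, continuous F}.
  by apply/differentiable_continuous/derivable1_diffP.
by split => //; [exact/cvg_at_right_filter/cF|exact/cvg_at_left_filter/cF].
Qed.

(* Substitute [x = rho * sin t]. *)
Lemma integral_half_chord (rho al be : R) : 0 < rho ->
  - (pi / 2) <= al -> al < be -> be <= pi / 2 ->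
  (\int[leb]_(x in `[(rho * sin al)%R, (rho * sin be)%R])
     (2 * Num.sqrt (rho ^+ 2 - x ^+ 2))%:E)%E
  = (rho ^+ 2 * (be + sin be * cos be) - rho ^+ 2 * (al + sin al * cos al))%:E.
Proof.
move=> rho0 al1 albe be1.
pose F (t : R) := rho * sin t.
have dF t : is_derive t (1:R) F (rho * cos t).
  by rewrite /F; apply: is_derive_eq.
have F'E : F^`()%classic = fun t => rho * cos t.
  by apply/funext => t; rewrite derive1E; apply: derive_val.
have cF' t : {for t, continuous (fun t => rho * cos t)}.
  apply: cvgM; [exact: cvg_cst|exact: continuous_cos].
rewrite (@integration_by_substitution_increasing R F
  (fun x => 2 * Num.sqrt (rho ^+ 2 - x ^+ 2)) al be (ltW albe)); last first.
- apply: continuous_subspaceT => x; apply: cvgM; first exact: cvg_cst.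
  apply: continuous_comp; last exact: sqrt_continuous.
  by apply: cvgB; [exact: cvg_cst|exact: exprn_continuous].
- by apply: continuous_derivable_oo => t; have [] := dF t.
- rewrite F'E; apply/cvg_ex; eexists; exact/cvg_at_left_filter/cF'.
- rewrite F'E; apply/cvg_ex; eexists; exact/cvg_at_right_filter/cF'.
- by rewrite F'E => t _; exact: cF'.
- move=> x y; rewrite !in_itv /= => /andP[x1 x2] /andP[y1 y2] xy.
  by rewrite /F ltr_pM2l // ltr_sin // in_itv /=; lra.
(* An antiderivative of the new integrand, because [2 * cos t ^+ 2 = 1 + (cos t ^+ 2 - sin t ^+
   2)]. *)
pose H (t : R) := rho ^+ 2 * (t + sin t * cos t).
have dH t : is_derive t (1:R) H (2 * rho ^+ 2 * cos t ^+ 2).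
  rewrite /H; apply: is_derive_eq.
  rewrite /GRing.scale /=.
  have -> : 2 * rho ^+ 2 * cos t ^+ 2 =
    rho ^+ 2 * (cos t ^+ 2 + sin t ^+ 2 + (cos t ^+ 2 - sin t ^+ 2)) by ring.
  by rewrite cos2Dsin2; ring.
rewrite -/(H be) -/(H al) EFinB.
rewrite -[RHS](@continuous_FTC2 R (fun t => 2 * rho ^+ 2 * cos t ^+ 2) H) //; last first.
- by move=> t _; rewrite derive1E; apply: derive_val.
- by apply: continuous_derivable_oo => t; have [] := dH t.
- apply: continuous_subspaceT => t; apply: cvgM; first exact: cvg_cst.
  apply: (@continuous_comp _ _ _ (@cos R) (fun u => u ^+ 2)).
    exact: continuous_cos.
  exact: exprn_continuous.
apply: eq_integral => t; rewrite inE /= in_itv /= => /andP[t1 t2].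
congr (_%:E); rewrite F'E.
transitivity (2 * Num.sqrt (rho ^+ 2 - (rho * sin t) ^+ 2) * (rho * cos t)); first by [].
have -> : rho ^+ 2 - (rho * sin t) ^+ 2 = (rho * cos t) ^+ 2.
  rewrite exprMn exprMn -[X in X - _]mulr1 -(cos2Dsin2 t); ring.
(* The cosine is nonnegative on this range of angles, which removes the absolute value. *)
rewrite sqrtr_sqr ger0_norm; first by ring.
by rewrite mulr_ge0 ?(ltW rho0) // cos_ge0_pihalf //; lra.
Qed.

Lemma leb2_segment (rho al be : R) : 0 < rho ->
  - (pi / 2) <= al -> al < be -> be <= pi / 2 ->
  leb2 [set z : pt | rho * sin al <= z.1 <= rho * sin be /\
                     z.2 ^+ 2 <= rho ^+ 2 - z.1 ^+ 2]
  = (rho ^+ 2 * (be + sin be * cos be) - rho ^+ 2 * (al + sin al * cos al))%:E.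
Proof.
move=> *; rewrite (@leb2_under_graph _ _ (fun x => rho ^+ 2 - x ^+ 2)).
  exact: integral_half_chord.
by apply: measurable_funB => //; exact: exprn_measurable.
Qed.

End CircularSegments.

(** * Planar Lebesgue measure as a measure structure *)

Section Leb2Measure.
Variable R : realType.
Let mu := product_measure1 (@lebesgue_measure R) (@lebesgue_measure R).

Let leb20 : @leb2 R set0 = 0%E.
Proof. exact: (@measure0 _ _ _ mu). Qed.

Let leb2_ge0 (A : set (R * R)) : (0 <= leb2 A)%E.
Proof. exact: (@measure_ge0 _ _ _ mu). Qed.

Let leb2_sigma_additive : semi_sigma_additive (@leb2 R).
Proof. exact: (@measure_semi_sigma_additive _ _ _ mu). Qed.

HB.instance Definition _ := isMeasure.Build _ _ _ (@leb2 R)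
  leb20 leb2_ge0 leb2_sigma_additive.

End Leb2Measure.

(** * Euclidean distance, discs and annuli *)

Section Discs.
Variable R : realType.
Local Notation pt := (R * R)%type.

Definition disc (a : pt) (rho : R) : set pt := [set z | edist a z <= rho].

(** The inner circle is excluded and the outer one included, to match distance intervals []s,
    t]]. *)
Definition annulus (a : pt) (s t : R) : set pt := disc a t `\` disc a s.

(** The region that must hold no further atom for [a] and [b] to be mutually nearest. *)
Definition two_discs (a b : pt) : set pt :=
  disc a (edist a b) `|` disc b (edist a b).

Lemma edist_ge0 (x y : pt) : 0 <= edist x y.
Proof. exact: sqrtr_ge0. Qed.

Lemma edistC (x y : pt) : edist x y = edist y x.
Proof. by rewrite /edist; congr Num.sqrt; ring. Qed.

Lemma edistxx (x : pt) : edist x x = 0.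
Proof. by rewrite /edist !subrr expr0n /= addr0 sqrtr0. Qed.

Lemma sqr_edist (x y : pt) :
  edist x y ^+ 2 = (x.1 - y.1) ^+ 2 + (x.2 - y.2) ^+ 2.
Proof. by rewrite sqr_sqrtr // addr_ge0 ?sqr_ge0. Qed.

Lemma edist_gt0 (x y : pt) : x <> y -> 0 < edist x y.
Proof.
move=> xy; rewrite lt_def edist_ge0 andbT; apply/eqP => h; apply: xy.
have := sqr_edist x y; rewrite h expr0n /= => /esym/eqP.
rewrite paddr_eq0 ?sqr_ge0 // !sqrf_eq0 !subr_eq0 => /andP[/eqP h1 /eqP h2].
by case: x y h1 h2 {h} => [? ?] [? ?] /= -> ->.
Qed.

(** Squaring leaves the Cauchy-Schwarz inequality, which follows from
    [0 <= (a * d - b * c) ^+ 2]. *)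
Lemma edist_triangle (x y z : pt) : edist x z <= edist x y + edist y z.
Proof.
have h0 := edist_ge0 x y; have h1 := edist_ge0 y z.
rewrite -[leLHS]ger0_norm ?edist_ge0 // -[leRHS]ger0_norm ?addr_ge0 //.
rewrite -ler_sqr ?nnegrE ?normr_ge0 // !real_normK ?num_real // sqrrD !sqr_edist.
set a := x.1 - y.1; set b := x.2 - y.2; set c := y.1 - z.1; set d := y.2 - z.2.
have -> : x.1 - z.1 = a + c by rewrite /a /c; ring.
have -> : x.2 - z.2 = b + d by rewrite /b /d; ring.
suff : a * c + b * d <= edist x y * edist y z by lra.
apply: le_trans (ler_norm _) _.
rewrite -[leRHS]ger0_norm ?mulr_ge0 // -ler_sqr ?nnegrE ?normr_ge0 //.
rewrite !real_normK ?num_real // exprMn !sqr_edist -/a -/b -/c -/d.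
have := sqr_ge0 (a * d - b * c); lra.
Qed.

Lemma disc_sqrE (a : pt) (rho : R) : 0 <= rho ->
  disc a rho = [set z | (z.1 - a.1) ^+ 2 + (z.2 - a.2) ^+ 2 <= rho ^+ 2].
Proof.
move=> rho0; apply/seteqP; split => z; rewrite /disc /= edistC -sqr_edist.
  by move=> h; rewrite ler_sqr ?nnegrE ?edist_ge0.
by rewrite ler_sqr ?nnegrE ?edist_ge0.
Qed.

Lemma measurable_disc (a : pt) (rho : R) : measurable (disc a rho).
Proof.
have [r0|r0] := leP 0 rho; last first.
  rewrite (_ : disc _ _ = set0) //; apply/seteqP; split => z //=.
  by rewrite /disc /= => /(le_trans (edist_ge0 _ _)); rewrite leNgt r0.
rewrite disc_sqrE //.
have := @measurable_fun_ler _ _ R setT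
  (fun z : pt => (z.1 - a.1) ^+ 2 + (z.2 - a.2) ^+ 2) (fun z : pt => rho ^+ 2).
move=> /(_ _ _)/(_ measurableT [set true]); rewrite setTI => h.
apply: (h _ _ _) => //.
by apply: measurable_funD; apply: measurable_funX; apply: measurable_funB.
Qed.

Lemma measurable_annulus a s t : measurable (annulus a s t).
Proof. by apply: measurableD; exact: measurable_disc. Qed.

Lemma measurable_two_discs a b : measurable (two_discs a b).
Proof. by apply: measurableU; exact: measurable_disc. Qed.

(** The slab of a centred disc between two vertical lines, given by angles so that its area has a
    closed form. *)
Definition segment (rho u v : R) : set pt :=
  [set z : pt | rho * sin u <= z.1 <= rho * sin v /\
                z.2 ^+ 2 <= rho ^+ 2 - z.1 ^+ 2].

Lemma measurable_segment rho u v : measurable (segment rho u v).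
Proof.
apply: (@measurable_under_graph _ _ _ (fun x => rho ^+ 2 - x ^+ 2)).
by apply: measurable_funB => //; exact: exprn_measurable.
Qed.

Lemma leb2_translate (p : pt) (A : set pt) : measurable A ->
  leb2 [set z | A (z.1 - p.1, z.2 - p.2)] = leb2 A.
Proof.
move=> mA; rewrite -[RHS](@leb2_rotation R 1 0 (- p.1) (- p.2) A) //.
- by congr leb2; apply/funext => z /=; congr (A (_, _)); ring.
- by ring.
- by apply/eqP; lra.
Qed.

Lemma disc_half_left (a : pt) (rho v : R) : 0 < rho -> v <= pi / 2 ->
  disc a rho `&` [set z | z.1 - a.1 <= rho * sin v] =
  [set z | segment rho (- (pi / 2)) v (z.1 - a.1, z.2 - a.2)].
Proof.
move=> rho0 vpi; rewrite disc_sqrE ?(ltW rho0) //.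
apply/seteqP; split => z; rewrite /segment /= sinN sin_pihalf.
  move=> [h1 h2]; split; last by lra.
  rewrite h2 andbT mulrN1.
  have : (z.1 - a.1) ^+ 2 <= rho ^+ 2 by have := sqr_ge0 (z.2 - a.2); lra.
  rewrite -[leLHS]real_normK ?num_real // ler_sqr ?nnegrE ?(ltW rho0) //.
  by rewrite ler_norml => /andP[].
by move=> [/andP[_ h1] h2]; split => //; lra.
Qed.

Lemma leb2_disc_half_left (a : pt) (rho v : R) : 0 < rho ->
  - (pi / 2) < v -> v <= pi / 2 ->
  leb2 (disc a rho `&` [set z | z.1 - a.1 <= rho * sin v]) =
  (rho ^+ 2 * (v + sin v * cos v + pi / 2))%:E.
Proof.
move=> rho0 v1 v2; rewrite disc_half_left // leb2_translate ?leb2_segment //.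
  by congr (_%:E); rewrite cosN cos_pihalf; ring.
exact: measurable_segment.
Qed.

Lemma leb2_disc (a : pt) (rho : R) : 0 < rho -> leb2 (disc a rho) = (pi * rho ^+ 2)%:E.
Proof.
move=> rho0; have p0 := pi_gt0 R.
(* Cutting at the angle [pi / 2] removes nothing from the disc. *)
rewrite -[disc a rho](_ : disc a rho `&` [set z | z.1 - a.1 <= rho * sin (pi / 2)] = _).
  rewrite leb2_disc_half_left //; last by lra.
  by congr (_%:E); rewrite cos_pihalf; field.
apply/seteqP; split => z; first by case.
move=> h; split => //; move: h; rewrite disc_sqrE ?(ltW rho0) //= sin_pihalf => h.
have : (z.1 - a.1) ^+ 2 <= rho ^+ 2 by have := sqr_ge0 (z.2 - a.2); lra.
rewrite -[leLHS]real_normK ?num_real // ler_sqr ?nnegrE ?(ltW rho0) //.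
by rewrite mulr1 ler_norml => /andP[].
Qed.

Lemma leb2_annulus (a : pt) (s t : R) : 0 < s -> s <= t ->
  leb2 (annulus a s t) = (pi * (t ^+ 2 - s ^+ 2))%:E.
Proof.
move=> s0 st; rewrite /annulus measureD ?measurable_disc //=; last first.
- by rewrite leb2_disc ?ltry //; lra.
- exact: measurable_disc.
- exact: measurable_disc.
rewrite setIidr; last by move=> z; rewrite /disc /= => /le_trans; exact.
by rewrite !leb2_disc; [congr (_%:E); ring|lra|lra].
Qed.

End Discs.

(** * The union of two discs passing through each other's centres *)

Section TwoDiscs.
Variable R : realType.
Local Notation pt := (R * R)%type.

(** The area of this union for centres at distance 1. *)
Definition mnn_area : R := 4 * pi / 3 + Num.sqrt 3 / 2.

(** [pi * gamma_mnn R] is the area of the lens common to the two unit discs, counted twice in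
    [2 * pi]. *)
Lemma mnn_areaE : mnn_area = pi * (2 - gamma_mnn R).
Proof.
have p0 : pi != 0 :> R by rewrite lt0r_neq0 // pi_gt0.
by rewrite /mnn_area /gamma_mnn; move: (pi : R) p0 => p p0; field.
Qed.

Lemma mnn_area_gt0 : 0 < mnn_area.
Proof. by have := pi_gt0 R; have := sqrtr_ge0 (3 : R); rewrite /mnn_area; lra. Qed.

Lemma two_discsC (a b : pt) : two_discs a b = two_discs b a.
Proof. by rewrite /two_discs setUC edistC. Qed.

(* Cut along the mediator line [z.1 = rho / 2]. *)
Lemma leb2_two_discs_horizontal (rho : R) : 0 < rho ->
  leb2 (two_discs (0, 0) (rho, 0)) = (mnn_area * rho ^+ 2)%:E.
Proof.
move=> rho0; have p0 := pi_gt0 R.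
(* The right part of the second disc is written as the complement of a left part, the shape whose
   area is known. *)
have -> : two_discs (0, 0) (rho, 0) =
    (disc (0, 0) rho `&` [set z | z.1 - 0 <= rho * sin (pi / 6)]) `|`
    (disc (rho, 0) rho `\`
      (disc (rho, 0) rho `&` [set z | z.1 - rho <= rho * sin (- (pi / 6))])).
  have -> : two_discs (0, 0) (rho, 0) = disc (0, 0) rho `|` disc (rho, 0) rho.
    rewrite /two_discs (_ : edist _ _ = rho) // /edist /= subrr sub0r sqrrN.
    by rewrite expr0n addr0 sqrtr_sqr gtr0_norm.
  rewrite sinN sin_pi6 !disc_sqrE ?(ltW rho0) //.
  apply/seteqP; split => z /=; rewrite !subr0.
    (* The squared distances to the two centres differ by [2 * rho * (rho / 2 - z.1)], so on either
       side a point of the union lies in the disc with the nearer centre. *)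
    have [h1|h1] := lerP (z.1) (rho / 2).
      move=> h; left; split; last by lra.
      case: h => // h.
      suff : 0 <= rho * (rho / 2 - z.1) by lra.
      by apply: mulr_ge0; lra.
    move=> h; right; split; last by move=> [_]; lra.
    case: h => // h.
    suff : 0 <= rho * (z.1 - rho / 2) by lra.
    by apply: mulr_ge0; lra.
  by case=> [[h _]|[h _]]; [left|right].
have md := @measurable_disc R.
have mh (a : pt) v : measurable (disc a rho `&` [set z | z.1 - a.1 <= rho * sin v]).
  apply: measurableI => //.
  rewrite (_ : [set _ | _] = [set z : pt | `]-oo, a.1 + rho * sin v]%classic z.1]).
    by apply: (measurable_preimageT (f := fst)) => //; exact: measurable_fst.
  by apply/seteqP; split => z /=; rewrite in_itv /= lerBlDl.
rewrite measureU /=; last first.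
- apply/seteqP; split => z //= [[_]]; rewrite subr0 sinN sin_pi6 => h [h1 h2].
  by apply: h2; split => //; lra.
- by apply: measurableD => //; exact: (mh (rho, 0)).
- exact: (mh (0, 0)).
rewrite measureD /=; last first.
- by rewrite leb2_disc ?ltry.
- exact: (mh (rho, 0)).
- exact: md.
rewrite [disc (rho, 0) rho `&` (_ `&` _)]setIA setIid.
rewrite (leb2_disc_half_left (0, 0)) //; [|lra|lra].
rewrite (leb2_disc_half_left (rho, 0)) //; [|lra|lra].
rewrite leb2_disc // -EFinB -EFinD sinN cosN sin_pi6 cos_pi6 /mnn_area.
by congr (_%:E); move: (pi : R) (Num.sqrt 3) {p0} => p q; field.
Qed.

Lemma leb2_two_discs (a b : pt) : a <> b ->
  leb2 (two_discs a b) = (mnn_area * edist a b ^+ 2)%:E.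
Proof.
move=> ab; set rho := edist a b.
have rho0 : 0 < rho by exact: edist_gt0.
(* Exchanging [a] and [b] reverses the direction and thus avoids the half-turn. *)
wlog cN1 : a b ab @rho rho0 / (b.1 - a.1) / rho != -1.
  move=> H; have [e|] := eqVneq ((b.1 - a.1) / rho) (-1); last exact: H.
  rewrite /rho edistC two_discsC; apply: H; [exact: nesym|by rewrite edistC|].
  rewrite edistC -/rho; apply/eqP; have -> : a.1 - b.1 = - (b.1 - a.1) by ring.
  by rewrite mulNr e; lra.
have rhoE : rho ^+ 2 = (a.1 - b.1) ^+ 2 + (a.2 - b.2) ^+ 2 by exact: sqr_edist.
have rN0 : rho != 0 by rewrite gt_eqF.
set c := (b.1 - a.1) / rho in cN1; set s := (b.2 - a.2) / rho.
have cs : c ^+ 2 + s ^+ 2 = 1.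
  rewrite /c /s !expr_div_n -mulrDl; apply: (canLR (mulfK _)); rewrite ?expf_eq0 //.
  by rewrite mul1r rhoE; ring.
transitivity (leb2 (two_discs (0, 0) (rho, 0))); last exact: leb2_two_discs_horizontal.
(* The translation part makes the motion take [a] to the origin and [b] to [(rho, 0)]. *)
have := leb2_rotation (- (c * a.1 + s * a.2)) (s * a.1 - c * a.2) cs cN1
  (measurable_two_discs (0, 0) (rho, 0)).
move=> <-.
congr leb2; apply/funext => z /=.
have cr : c * rho = b.1 - a.1 by rewrite /c divfK.
have sr : s * rho = b.2 - a.2 by rewrite /s divfK.
set z' := (c * z.1 + s * z.2 + _, _).
have h1 : edist (0, 0) z' = edist a z.
  rewrite /z' /edist /=; congr Num.sqrt.
  transitivity ((c ^+ 2 + s ^+ 2) * ((a.1 - z.1) ^+ 2 + (a.2 - z.2) ^+ 2)); first by ring.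
  by rewrite cs mul1r.
have h2 : edist (rho, 0) z' = edist b z.
  rewrite /z' /edist /=; congr Num.sqrt.
  transitivity ((c ^+ 2 + s ^+ 2) * ((a.1 - z.1) ^+ 2 + (a.2 - z.2) ^+ 2)
    + 2 * (c * rho * (a.1 - z.1) + s * rho * (a.2 - z.2)) + rho ^+ 2); first by ring.
  by rewrite cs cr sr rhoE; ring.
have h3 : edist ((0, 0) : pt) (rho, 0) = rho.
  by rewrite /edist /= subrr sub0r sqrrN expr0n addr0 sqrtr_sqr gtr0_norm.
by rewrite /two_discs /disc /= h3 h1 h2.
Qed.

End TwoDiscs.

(** * Upper and lower integrals *)

Section UpperLowerIntegrals.
Context (R : realType) (d : measure_display) (T : measurableType d)
  (mu : {measure set T -> \bar R}).
Implicit Types f g : T -> \bar R.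
Local Open Scope ereal_scope.

(** The integral of a nonnegative function is a supremum over simple functions below it, hence
    monotone even without measurability. *)
Lemma ge0_le_integral_nonmeas f g : (forall w, 0 <= f w) ->
  (forall w, f w <= g w) -> \int[mu]_w f w <= \int[mu]_w g w.
Proof.
move=> f0 fg; rewrite !ge0_integralTE //; last first.
  by move=> w; exact: le_trans (fg w).
by apply: le_ereal_sup => _ [h hf <-]; exists h => // w; exact: le_trans (fg w).
Qed.

(* Upper and lower integrals, because the measurability of the counts of mutually
   nearest pairs is not available a priori. *)
Definition upper_le f (a : R) : Prop := forall e : R, (0 < e)%R ->
  exists g, [/\ measurable_fun setT g, (forall w, 0 <= g w),
    (forall w, f w <= g w) & \int[mu]_w g w <= (a + e)%:E].

Definition lower_ge f (a : R) : Prop := forall e : R, (0 < e)%R ->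
  exists g, [/\ measurable_fun setT g, (forall w, 0 <= g w),
    (forall w, g w <= f w) & (a - e)%:E <= \int[mu]_w g w].

Lemma upper_le_integral f a : (forall w, 0 <= f w) -> upper_le f a ->
  \int[mu]_w f w <= a%:E.
Proof.
move=> f0 fa; apply/lee_addgt0Pr => e e0; have [g [mg g0 fg ig]] := fa _ e0.
by rewrite -EFinD; apply: le_trans ig; exact: ge0_le_integral_nonmeas.
Qed.

Lemma lower_ge_integral f a : lower_ge f a -> a%:E <= \int[mu]_w f w.
Proof.
move=> fa; apply/lee_addgt0Pr => e e0; have [g [mg g0 gf ig]] := fa _ e0.
rewrite -leeBlDr //; apply: le_trans ig _; exact: ge0_le_integral_nonmeas.
Qed.

(** Lets the mesh of a grid or of a subdivision tend to 0 in the bound alone. *)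
Lemma upper_le_closed f a :
  (forall e : R, (0 < e)%R -> exists2 b, upper_le f b & (b <= a + e)%R) -> upper_le f a.
Proof.
move=> fa e e0; have e2 : (0 < e / 2)%R by apply: divr_gt0.
have [b fb ba] := fa _ e2; have [g [mg g0 fg ig]] := fb _ e2.
by exists g; split => //; apply: le_trans ig _; rewrite lee_fin; lra.
Qed.

Lemma lower_ge_closed f a :
  (forall e : R, (0 < e)%R -> exists2 b, lower_ge f b & (a - e <= b)%R) -> lower_ge f a.
Proof.
move=> fa e e0; have e2 : (0 < e / 2)%R by apply: divr_gt0.
have [b fb ba] := fa _ e2; have [g [mg g0 fg ig]] := fb _ e2.
by exists g; split => //; apply: le_trans ig; rewrite lee_fin; lra.
Qed.

Lemma upper_leW f f' a a' : (forall w, f' w <= f w) -> (a <= a')%R ->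
  upper_le f a -> upper_le f' a'.
Proof.
move=> ff' aa' fa e e0; have [g [mg g0 fg ig]] := fa _ e0.
exists g; split => //; first by move=> w; exact: le_trans (ff' w) (fg w).
by apply: le_trans ig _; rewrite lee_fin; lra.
Qed.

Lemma lower_geW f f' a a' : (forall w, f w <= f' w) -> (a' <= a)%R ->
  lower_ge f a -> lower_ge f' a'.
Proof.
move=> ff' aa' fa e e0; have [g [mg g0 fg ig]] := fa _ e0.
exists g; split => //; first by move=> w; exact: le_trans (fg w) (ff' w).
by apply: le_trans ig; rewrite lee_fin; lra.
Qed.

Lemma upper_leD f f' a a' : upper_le f a -> upper_le f' a' ->
  upper_le (fun w => f w + f' w) (a + a')%R.
Proof.
move=> fa fa' e e0; have e2 : (0 < e / 2)%R by apply: divr_gt0.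
have [g [mg g0 fg ig]] := fa _ e2; have [g' [mg' g'0 fg' ig']] := fa' _ e2.
exists (fun w => g w + g' w); split.
- exact: emeasurable_funD.
- by move=> w; exact: adde_ge0.
- by move=> w; exact: leeD.
- rewrite ge0_integralD //; apply: le_trans (leeD ig ig') _.
  by rewrite -EFinD lee_fin; lra.
Qed.

Lemma lower_geD f f' a a' : lower_ge f a -> lower_ge f' a' ->
  lower_ge (fun w => f w + f' w) (a + a')%R.
Proof.
move=> fa fa' e e0; have e2 : (0 < e / 2)%R by apply: divr_gt0.
have [g [mg g0 fg ig]] := fa _ e2; have [g' [mg' g'0 fg' ig']] := fa' _ e2.
exists (fun w => g w + g' w); split.
- exact: emeasurable_funD.
- by move=> w; exact: adde_ge0.
- by move=> w; exact: leeD.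
- rewrite ge0_integralD //; apply: le_trans (leeD ig ig').
  by rewrite -EFinD lee_fin; lra.
Qed.

(** Monotone convergence, applied to measurable majorants of the terms. *)
Lemma upper_le_series (f : nat -> T -> \bar R) (a : nat -> R) (s : R) :
  (forall k, (0 <= a k)%R) -> (forall n, (\sum_(0 <= k < n) a k <= s)%R) ->
  (forall k w, 0 <= f k w) -> (forall k, upper_le (f k) (a k)) ->
  upper_le (fun w => \sum_(0 <= k <oo) f k w) s.
Proof.
move=> a0 as_ f0 fa e e0.
(* The tolerance is split geometrically, so that the errors of all terms add up to at most [e]. *)
have ek k : (0 < e / (2 ^ k.+1)%:R)%R by rewrite divr_gt0 // ltr0n expn_gt0.
have /choice[g gP] : forall k, exists g, [/\ measurable_fun setT g, (forall w, 0 <= g w),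
    (forall w, f k w <= g w) & \int[mu]_w g w <= (a k + e / (2 ^ k.+1)%:R)%:E].
  by move=> k; exact: fa.
have mg k : measurable_fun setT (g k) by have [] := gP k.
have g0 k w : 0 <= g k w by have [] := gP k.
have fg k w : f k w <= g k w by have [] := gP k.
exists (fun w => \sum_(0 <= k <oo) g k w); split.
- by apply: ge0_emeasurable_sum => // k w _ _.
- by move=> w; exact: nneseries_ge0.
- by move=> w; apply: lee_nneseries => // k _ _.
rewrite integral_nneseries //.
apply: (@le_trans _ _ (\sum_(0 <= k <oo) ((a k)%:E + (e / (2 ^ k.+1)%:R)%:E))).
  apply: lee_nneseries => [k _ _|k _]; first by apply: integral_ge0.
  by rewrite -EFinD; have [] := gP k.
apply: le_trans (epsilon_trick _ _ (ltW e0)) _; first by move=> k; rewrite lee_fin.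
rewrite EFinD leeD2r //; apply: lime_le.
  by apply: is_cvg_nneseries => k _ _; rewrite lee_fin.
by apply: nearW => n; rewrite sumEFin lee_fin.
Qed.

End UpperLowerIntegrals.

(** * Counting atoms in the cells of a grid *)

Section Counting.
Variable R : realType.
Local Notation pt := (R * R)%type.
Implicit Types phi A B : set pt.

Lemma cnt_ge0 phi B : (0 <= cnt phi B)%E.
Proof. exact: esum_ge0. Qed.

Lemma cnt_set0 phi B : phi `&` B = set0 -> cnt phi B = 0%E.
Proof. by rewrite /cnt => ->; rewrite esum_set0. Qed.

Lemma cnt_set1 phi B x : phi `&` B = [set x] -> cnt phi B = 1%E.
Proof. by rewrite /cnt => ->; rewrite esum_set1. Qed.

Lemma cnt_ge1 phi B x : phi x -> B x -> (1 <= cnt phi B)%E.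
Proof.
move=> hx Bx; apply: esum_ge; exists [set x].
  by split; [exact: finite_set1|move=> _ ->].
by rewrite fsbig_set1.
Qed.

Lemma cnt_ge2 phi B x y : phi x -> B x -> phi y -> B y -> x <> y ->
  (2%:R%:E <= cnt phi B)%E.
Proof.
move=> hx Bx hy By xy; apply: esum_ge; exists ([set x] `|` [set y]).
  by split; [rewrite finite_setU; split; exact: finite_set1|move=> _ [] ->].
rewrite fsbigU //=; first by rewrite !fsbig_set1 -EFinD lee_fin; lra.
by move=> z [-> /= e]; case: xy.
Qed.

Lemma cnt0P phi B : cnt phi B = 0%E -> forall x, phi x -> B x -> False.
Proof. by move=> h x hx Bx; have := cnt_ge1 hx Bx; rewrite h lee_fin ler10. Qed.

Lemma cnt1P phi B : cnt phi B = 1%E -> exists x,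
  [/\ phi x, B x & forall z, phi z -> B z -> z = x].
Proof.
move=> h; have [/cnt_set0 h0|/set0P[x [hx Bx]]] := eqVneq (phi `&` B) set0.
  by move: h; rewrite h0 => /eqP; rewrite eqe eq_sym oner_eq0.
exists x; split => // z hz Bz; apply: contrapT => zx.
by have := cnt_ge2 hz Bz hx Bx zx; rewrite h lee_fin; lra.
Qed.

Lemma cnt_le phi phi' B : phi `<=` phi' -> (cnt phi B <= cnt phi' B)%E.
Proof.
move=> s; rewrite /cnt esum_mkcond [leRHS]esum_mkcond; apply: le_esum => x _.
case: ifPn; last by case: ifP.
by rewrite inE => -[/s h1 h2]; rewrite ifT // inE.
Qed.

Lemma cntU phi phi' B : phi `&` phi' = set0 ->
  cnt (phi `|` phi') B = (cnt phi B + cnt phi' B)%E.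
Proof.
move=> dis; rewrite /cnt (esumID phi) //.
congr (_ + _)%E; congr esum; apply/seteqP; split => x /=.
- by move=> [[_ ?] ?].
- by move=> [? ?]; split => //; split => //; left.
- by move=> [[[?|?] ?] ?].
- move=> [h1 h2]; split; first by split => //; right.
  by move=> h3; have : (phi `&` phi') x by []; rewrite dis.
Qed.

Lemma cnt_bigcup (S : nat -> set pt) B : trivIset setT S ->
  cnt (\bigcup_k S k) B = (\sum_(0 <= k <oo) cnt (S k) B)%E.
Proof.
move=> tS; rewrite /cnt setI_bigcupl nneseries_sum_bigcup //.
by apply: trivIset_setIr.
Qed.

(** Each atom of [B] lies in exactly one cell; exchange the sums over cells and over atoms. *)
Lemma cnt_sum_partition (I : finType) phi B (Q : I -> set pt) :
  (forall i j, i != j -> Q i `&` Q j = set0) ->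
  (forall z, B z -> exists i, Q i z) ->
  cnt phi B = (\sum_i cnt phi (B `&` Q i))%E.
Proof.
move=> dis cov; rewrite /cnt esum_mkcond.
under eq_bigr do rewrite esum_mkcond.
rewrite -esum_sum => [|x i _ _]; last by case: ifP.
apply: eq_esum => x _; case: ifPn => [|hx]; last first.
  rewrite big1 // => i _; rewrite ifF //; apply/negbTE; apply: contra hx.
  by rewrite !inE => -[h1 [h2 h3]].
rewrite inE => -[hx Bx]; have [i Qi] := cov x Bx.
rewrite (bigD1 i) //= ifT ?inE // big1 ?adde0 // => j ji.
rewrite ifF //; apply/negbTE; rewrite notin_setE => -[_ [_ Qj]].
by have : (Q j `&` Q i) x by []; rewrite dis.
Qed.

Lemma grid_partition1 (h : R) (N : nat) (y : R) : 0 <= y -> y < h * N%:R -> 0 < h ->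
  exists i : 'I_N, h * i%:R <= y < h * i.+1%:R.
Proof.
move=> y0 yN h0; have yh : 0 <= y / h by rewrite divr_ge0 // ltW.
have := truncn_itv yh => /andP[h1 h2].
have lt : (Num.truncn (y / h) < N)%N.
  by rewrite -(ltr_nat R); apply: le_lt_trans h1 _; rewrite ltr_pdivrMr // mulrC.
exists (Ordinal lt) => /=; rewrite mulrC -ler_pdivlMr // h1 /=.
by rewrite mulrC -ltr_pdivrMr.
Qed.

Lemma grid_unique1 (h y : R) (i j : nat) : 0 < h ->
  h * i%:R <= y < h * i.+1%:R -> h * j%:R <= y < h * j.+1%:R -> i = j.
Proof.
move=> h0 /andP[i1 i2] /andP[j1 j2]; apply: anti_leq; apply/andP; split.
  by have := le_lt_trans i1 j2; rewrite ltr_pM2l // ltr_nat ltnS.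
by have := le_lt_trans j1 i2; rewrite ltr_pM2l // ltr_nat ltnS.
Qed.

(** Half-open squares of side [e / 2], shifted by [M]; the centre [a i] is the lower left corner,
    within [e] of the whole square. *)
Lemma fine_partition (M e : R) : 0 < M -> 0 < e ->
  exists (I : finType) (Q : I -> set pt) (a : I -> pt),
  [/\ forall i, measurable (Q i), forall i j, i != j -> Q i `&` Q j = set0,
      forall z, edist (0, 0) z <= M -> exists i, Q i z
    & forall i, Q i `<=` disc (a i) e].
Proof.
move=> M0 e0; pose h := e / 2; have h0 : 0 < h by rewrite divr_gt0.
pose N := (Num.truncn (2 * M / h)).+1.
have NM : 2 * M < h * N%:R.
  by rewrite [ltRHS]mulrC -ltr_pdivrMr // truncnS_gt.
pose Q (i : 'I_N * 'I_N) : set pt :=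
  [set z | h * i.1%:R <= z.1 + M < h * i.1.+1%:R /\ h * i.2%:R <= z.2 + M < h * i.2.+1%:R].
pose a (i : 'I_N * 'I_N) : pt := (h * i.1%:R - M, h * i.2%:R - M).
exists ('I_N * 'I_N)%type, Q, a; split.
- move=> i; pose J (k : nat) := `[(h * k%:R - M), (h * k.+1%:R - M)[%classic : set R.
  rewrite (_ : Q i = J i.1 `*` J i.2); first by apply: measurableX; exact: measurable_itv.
  by apply/seteqP; split => z; rewrite /Q /J /= !in_itv /= !lerBlDr !ltrBrDr.
- move=> [i1 i2] [j1 j2] ij; apply/seteqP; split => z //= -[[h1 h2] [h3 h4]].
  move/eqP: ij; apply; congr (_, _); apply: val_inj => /=.
    exact: (grid_unique1 h0 h1 h3).
  exact: (grid_unique1 h0 h2 h4).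
- move=> z zM; have z2 : z.1 ^+ 2 + z.2 ^+ 2 <= M ^+ 2.
    have := sqr_edist (0, 0) z; rewrite /= !sub0r !sqrrN => <-.
    by rewrite ler_sqr ?nnegrE ?edist_ge0 ?(ltW M0).
  have b1 : - M <= z.1 <= M.
    rewrite -ler_norml -[leRHS]gtr0_norm // -ler_sqr ?nnegrE // !real_normK ?num_real //.
    by have := sqr_ge0 z.2; lra.
  have b2 : - M <= z.2 <= M.
    rewrite -ler_norml -[leRHS]gtr0_norm // -ler_sqr ?nnegrE // !real_normK ?num_real //.
    by have := sqr_ge0 z.1; lra.
  have [|||i1 hi1] := @grid_partition1 h N (z.1 + M) => //; [lra|lra|].
  have [|||i2 hi2] := @grid_partition1 h N (z.2 + M) => //; [lra|lra|].
  by exists (i1, i2).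
- move=> i z [/andP[h1 h2] /andP[h3 h4]]; rewrite disc_sqrE ?(ltW e0) //=.
  have hh k : h * k.+1%:R = h * k%:R + h by rewrite -natr1; ring.
  rewrite !hh in h2 h4.
  have eh : e = 2 * h by rewrite /h; field.
  have sq (u : R) : 0 <= u -> u < h -> u ^+ 2 <= h ^+ 2.
    by move=> u0 uh; rewrite ler_sqr ?nnegrE ?(ltW h0) // ltW.
  have q1 : (z.1 - (h * i.1%:R - M)) ^+ 2 <= h ^+ 2 by apply: sq; lra.
  have q2 : (z.2 - (h * i.2%:R - M)) ^+ 2 <= h ^+ 2 by apply: sq; lra.
  by rewrite eh exprMn; have := sqr_ge0 h; lra.
Qed.

(** Meaningful on bounded sets; [fine] sends an infinite measure to 0. *)
Definition area (B : set pt) : R := fine (leb2 B).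

Lemma bounded_subset A B : A `<=` B -> bounded_set B -> bounded_set A.
Proof. by move=> AB [M BM]; exists M => z /AB /BM. Qed.

Lemma bounded_disc (a : pt) (rho : R) : bounded_set (disc a rho).
Proof.
exists (edist (0, 0) a + rho) => z; rewrite /disc /= => az.
by have := edist_triangle (0, 0) a z; lra.
Qed.

Lemma bounded_setU A B : bounded_set A -> bounded_set B -> bounded_set (A `|` B).
Proof.
move=> [M AM] [N BN]; exists (Num.max M N) => z [/AM|/BN] h;
  by rewrite le_max h ?orbT.
Qed.

Lemma area_ge0 B : 0 <= area B.
Proof. by rewrite fine_ge0. Qed.

Lemma leb2_area B : measurable B -> bounded_set B -> leb2 B = (area B)%:E.
Proof.
move=> mB [M BM]; rewrite /area fineK // ge0_fin_numE //.
(* The area of a disc is available for positive radii, while [M] may be nonpositive. *)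
pose N := Num.max M 1; have N0 : 0 < N by rewrite lt_max ltr01 orbT.
have le : (leb2 B <= leb2 (disc (0, 0)%R N))%E.
  apply: le_measure; rewrite ?inE //; first exact: measurable_disc.
  by move=> z /BM h; rewrite /disc /=; rewrite le_max h.
by apply: le_lt_trans le _; rewrite leb2_disc // ltry.
Qed.

Lemma area_le A B : measurable A -> measurable B -> bounded_set B -> A `<=` B ->
  area A <= area B.
Proof.
move=> mA mB bB AB; rewrite -lee_fin -!leb2_area //; last exact: bounded_subset bB.
by apply: le_measure; rewrite ?inE.
Qed.

Lemma areaU A B : measurable A -> measurable B -> bounded_set A -> bounded_set B ->
  A `&` B = set0 -> area (A `|` B) = area A + area B.
Proof.
move=> mA mB bA bB AB; apply: EFin_inj.
rewrite EFinD -!leb2_area //; first by rewrite measureU.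
  exact: measurableU.
exact: bounded_setU.
Qed.

(** Upper estimates use the inequality, lower ones the equality for a covered set. *)
Lemma area_partition (I : finType) B (Q : I -> set pt) :
  measurable B -> bounded_set B -> (forall i, measurable (Q i)) ->
  (forall i j, i != j -> Q i `&` Q j = set0) ->
  (\sum_i area (B `&` Q i) <= area B /\
   ((forall z, B z -> exists i, Q i z) -> \sum_i area (B `&` Q i) = area B)).
Proof.
move=> mB bB mQ dis.
have bBQ i : bounded_set (B `&` Q i) by apply: bounded_subset bB; exact: subIsetl.
have mBQ i : measurable (B `&` Q i) by apply: measurableI.
have fT : finite_set [set: I] by exact: finite_finset.
have mU : measurable (\bigcup_i (B `&` Q i)) by exact: fin_bigcup_measurable.
have sU : \bigcup_i (B `&` Q i) `<=` B by move=> z [i _ []].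
have E : \sum_i area (B `&` Q i) = area (\bigcup_i (B `&` Q i)).
  apply: EFin_inj; rewrite -leb2_area //; last exact: bounded_subset bB.
  rewrite -sumEFin (eq_bigr (fun i => leb2 (B `&` Q i))); last first.
    by move=> i _; rewrite leb2_area.
  rewrite measure_fin_bigcup //; last first.
    apply/trivIsetP => i j _ _ ij.
    by rewrite setIACA dis // setI0.
  rewrite fsbig_finite //; apply: perm_big; apply: uniq_perm.
  - exact: index_enum_uniq.
  - exact: finmap.fset_uniq.
  - by move=> i; rewrite mem_index_enum in_fset_set // in_setT.
split; first by rewrite E; exact: area_le.
move=> cov; rewrite E; congr area; apply/seteqP; split => // z Bz.
by have [i Qi] := cov z Bz; exists i.
Qed.

End Counting.

(** * Mutually nearest atoms in a pair of cells *)

Section PairEstimates.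
Variable R : realType.
Local Notation pt := (R * R)%type.

(** The parameter [h] is measured from [a]; a negative value goes beyond [a], away from [b]. *)
Definition interpolate (h : R) (a b : pt) : pt :=
  (a.1 + h * (b.1 - a.1), a.2 + h * (b.2 - a.2)).

Lemma edist_interpolate (h : R) (a b : pt) :
  edist a (interpolate h a b) = `|h| * edist a b.
Proof.
rewrite /edist /interpolate /=.
rewrite -[X in _ = X * _]sqrtr_sqr -sqrtrM ?sqr_ge0 //; congr Num.sqrt; ring.
Qed.

Lemma edist_interpolate2 (h : R) (a b : pt) :
  edist (interpolate h a b) (interpolate h b a) = `|1 - 2 * h| * edist a b.
Proof.
rewrite /edist /interpolate /=.
rewrite -[X in _ = X * _]sqrtr_sqr -sqrtrM ?sqr_ge0 //; congr Num.sqrt; ring.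
Qed.

Lemma bounded_two_discs (a b : pt) : bounded_set (two_discs a b).
Proof. by apply: bounded_setU; exact: bounded_disc. Qed.

Lemma area_two_discs (a b : pt) : a <> b ->
  area (two_discs a b) = mnn_area R * edist a b ^+ 2.
Proof. by move=> ab; rewrite /area leb2_two_discs. Qed.

(** Moving each centre inwards by [3 * e] shrinks the radius by [6 * e]; this pays for the
    displacement [3 * e], for [e] between [a']s origin and [x], and for [2 * e] in the distance of
    [x] and [y]. *)
Lemma two_discs_inner (a b : pt) (e : R) : 0 < e -> 6 * e < edist a b ->
  exists a' b' : pt, [/\ a' <> b', edist a' b' = edist a b - 6 * e &
    forall x y, edist a x <= e -> edist b y <= e ->
      two_discs a' b' `<=` two_discs x y].
Proof.
move=> e0 ab6; have ab0 : 0 < edist a b by lra.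
pose h := 3 * e / edist a b; pose a' := interpolate h a b; pose b' := interpolate h b a.
have h0 : 0 <= h by rewrite divr_ge0 ?edist_ge0 //; lra.
have hab : h * edist a b = 3 * e by rewrite /h divfK // gt_eqF.
have h1 : 2 * h < 1 by rewrite -(ltr_pM2r ab0) -mulrA hab; lra.
have aa' : edist a a' = 3 * e by rewrite edist_interpolate ger0_norm.
have bb' : edist b b' = 3 * e by rewrite edist_interpolate ger0_norm // edistC.
have a'b' : edist a' b' = edist a b - 6 * e.
  by rewrite edist_interpolate2 ger0_norm; [rewrite mulrBl -mulrA hab; ring|lra].
exists a', b'; split => //.
  by move=> E; move: a'b'; rewrite E edistxx; lra.
move=> x y ax bY z.
have t1 := edist_triangle a x y; have t2 := edist_triangle a y b.
have t3 := edist_triangle x a a'; have t4 := edist_triangle x a' z.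
have t5 := edist_triangle y b b'; have t6 := edist_triangle y b' z.
rewrite (edistC y b) (edistC x a) in t2 t3 t5.
by case; rewrite /disc /= a'b' => hz; [left|right]; rewrite /disc /=; lra.
Qed.

(** The same balance with the centres moved outwards by [3 * e]. *)
Lemma two_discs_outer (a b : pt) (e : R) : 0 < e -> 0 < edist a b ->
  exists a' b' : pt, [/\ a' <> b', edist a' b' = edist a b + 6 * e &
    forall x y, edist a x <= e -> edist b y <= e ->
      two_discs x y `<=` two_discs a' b'].
Proof.
move=> e0 ab0.
pose h := 3 * e / edist a b.
pose a' := interpolate (- h) a b; pose b' := interpolate (- h) b a.
have h0 : 0 <= h by rewrite divr_ge0 ?edist_ge0 //; lra.
have hab : h * edist a b = 3 * e by rewrite /h divfK // gt_eqF.
have aa' : edist a a' = 3 * e by rewrite edist_interpolate normrN ger0_norm.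
have bb' : edist b b' = 3 * e by rewrite edist_interpolate normrN ger0_norm // edistC.
have a'b' : edist a' b' = edist a b + 6 * e.
  by rewrite edist_interpolate2 ger0_norm; [rewrite mulrBl -mulrA mulNr hab; ring|lra].
exists a', b'; split => //.
  by move=> E; move: a'b'; rewrite E edistxx; lra.
move=> x y ax bY z.
have t1 := edist_triangle x a b; have t2 := edist_triangle x b y.
have t3 := edist_triangle a' a x; have t4 := edist_triangle a' x z.
have t5 := edist_triangle b' b y; have t6 := edist_triangle b' y z.
rewrite (edistC x a) in t1; rewrite (edistC a' a) in t3; rewrite (edistC b' b) in t5.
by case; rewrite /disc /= => hz; [left|right]; rewrite /disc /= a'b'; lra.
Qed.

Lemma poisson_mass0 (m : R) : poisson_mass m 0 = expR (- m).
Proof. by rewrite /poisson_mass expr0 mulr1 divr1. Qed.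

Lemma poisson_mass1 (m : R) : poisson_mass m 1 = expR (- m) * m.
Proof. by rewrite /poisson_mass expr1 divr1. Qed.

Context (d : measure_display) (Omega : measurableType d)
  (P : probability Omega R) (Phi : Omega -> set pt) (lam : R).
Hypotheses (lam0 : 0 < lam) (pPhi : is_poisson_pp P Phi lam).

(** [Q] and [p] are the cells of the two partners, [D] the region kept free of atoms. *)
Definition pair_event (Q p D : set pt) : set Omega :=
  [set w | [/\ cnt (Phi w) Q = 1%E, cnt (Phi w) p = 1%E & cnt (Phi w) D = 0%E]].

(** Counts in disjoint sets are independent Poisson variables; the three exponentials combine into
    one. *)
Lemma pair_event_prob (Q p D : set pt) :
  measurable Q -> measurable p -> measurable D ->
  bounded_set Q -> bounded_set p -> bounded_set D ->
  Q `&` p = set0 -> Q `&` D = set0 -> p `&` D = set0 ->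
  measurable (pair_event Q p D) /\
  P (pair_event Q p D) =
    (lam ^+ 2 * area Q * area p * expR (- (lam * (area Q + area p + area D))))%:E.
Proof.
move=> mQ mp mD bQ bp bD Qp QD pD.
have [_ mes fdd] := pPhi.
pose B (i : 'I_3) : set pt := nth set0 [:: Q; p; D] i.
pose n (i : 'I_3) : nat := nth 0%N [:: 1; 1; 0]%N i.
have E : pair_event Q p D =
    \bigcap_(i in [set: 'I_3]) [set w | cnt (Phi w) (B i) = ((n i)%:R)%:E].
  apply/seteqP; split => w /=.
    by move=> [h1 h2 h3] [[|[|[|]]]] //= hi _; rewrite /B /n /=.
  move=> h; split.
  - exact: (h (@Ordinal 3 0 isT)).
  - exact: (h (@Ordinal 3 1 isT)).
  - exact: (h (@Ordinal 3 2 isT)).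
have mB (i : 'I_3) : measurable (B i) /\ bounded_set (B i).
  by case: i => [[|[|[|]]]].
split.
  rewrite E; apply: fin_bigcap_measurable => [|i _]; first exact: finite_finset.
  by have [? ?] := mB i; exact: mes.
rewrite E fdd //; last first.
  by move=> [[|[|[|?]]] ?] [[|[|[|?]]] ?] //= _; rewrite /B /= // setIC.
congr (_%:E).
transitivity (poisson_mass (lam * area Q) 1 *
  (poisson_mass (lam * area p) 1 * (poisson_mass (lam * area D) 0 * 1))).
  by rewrite !big_ord_recl big_ord0.
rewrite !poisson_mass1 poisson_mass0.
move: (area Q) (area p) (area D) => u v x.
have -> : - (lam * (u + v + x)) = - (lam * u) + (- (lam * v) + - (lam * x)) by ring.
rewrite !expRD; move: (expR _) (expR _) (expR _) => eu ev ex; ring.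
Qed.

(** * Mutually nearest pairs and empty regions *)

Lemma mnnr_excl (phi : set pt) x y z : mnnr phi x y -> phi z -> z <> x -> z <> y ->
  ~ two_discs x y z.
Proof.
move=> [px [py [[_ [_ nxy]] [_ [_ nyx]]]]] pz zx zy [].
  by rewrite /disc /= leNgt nxy.
by rewrite /disc /= leNgt (edistC x y) nyx.
Qed.

(** Closed discs fit the strict inequality in [nn]. *)
Lemma mnnr_of_excl (phi : set pt) x y : phi x -> phi y -> x <> y ->
  (forall z, phi z -> z <> x -> z <> y -> ~ two_discs x y z) -> mnnr phi x y.
Proof.
move=> px py xy ex; split => //; split => //; split; split => //; split => //.
- exact: nesym.
- move=> z pz zx zy; rewrite ltNge; apply/negP => h.
  by apply: (ex z) => //; left.
- move=> z pz zy zx; rewrite ltNge; apply/negP => h.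
  by apply: (ex z) => //; right; rewrite /disc /= (edistC x y).
Qed.

Lemma mnnr_neq (phi : set pt) x y : mnnr phi x y -> y <> x.
Proof. by move=> [_ [_ [[_ []]]]]. Qed.

Lemma mnnr_near (phi : set pt) x y z : mnnr phi x y -> phi z -> z <> x ->
  edist x z < edist x y -> False.
Proof.
move=> [_ [_ [[py [yx h]] _]]] pz zx; have [->|/eqP zy] := eqVneq z y.
  by rewrite ltxx.
by have := h z pz zx zy; lra.
Qed.

(** Of two different partners each would be strictly nearer to [x] than the other. *)
Lemma mnnr_uniq (phi : set pt) x y z : mnnr phi x y -> mnnr phi x z -> y = z.
Proof.
move=> [_ [py [[_ [yx hy]] _]]] [_ [pz [[_ [zx hz]] _]]].
apply: contrapT => yz; 
by have := lt_trans (hy z pz zx (nesym yz)) (hz y py yx yz); rewrite ltxx.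
Qed.

Lemma mnnrC (phi : set pt) x y : mnnr phi x y -> mnnr phi y x.
Proof. by move=> [? [? [? ?]]]. Qed.

(** Partners further apart than [s] leave no room for another atom in their own small cells or in
    the shrunken union of discs [V], so [pair_event] occurs. *)
Lemma pair_upper (s e : R) (a b : pt) (Q p : set pt) : 0 < e -> 8 * e < s ->
  measurable Q -> measurable p -> Q `<=` disc a e -> p `<=` disc b e ->
  (forall y, p y -> s - e < edist a y) ->
  exists E : set Omega, [/\ measurable E,
    (P E <= (lam ^+ 2 * area Q * area p * expR (- (lam * mnn_area R * (s - 8 * e) ^+ 2)))%:E)%E
    & forall w x y, Q x -> p y -> mnnr (Phi w) x y -> s < edist x y -> E w].
Proof.
move=> e0 es mQ mp Qa pb pa.
have w0 : 0 <= lam ^+ 2 * area Q * area p.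
  by apply: mulr_ge0; [apply: mulr_ge0|]; rewrite ?area_ge0 ?sqr_ge0.
(* A point of [p] is what bounds the distance from [a] to [b]; for empty [p] the empty event
   serves. *)
have [p0|/set0P[y0 py0]] := eqVneq p set0.
  exists set0; split => //; last by move=> w x y _; rewrite p0.
  by rewrite measure0 lee_fin mulr_ge0 // expR_ge0.
have ab : s - 2 * e < edist a b.
  have := pa _ py0; have := pb _ py0; rewrite /disc /=.
  by have := edist_triangle a b y0; lra.
have [||a' [b' [a'b' dab' inc]]] := @two_discs_inner a b e => //; first by lra.
set V := two_discs a' b'.
pose D := V `\` (Q `|` p).
have mV : measurable V by exact: measurable_two_discs.
have mD : measurable D by apply: measurableD => //; exact: measurableU.
have bV : bounded_set V by exact: bounded_two_discs.
have bD : bounded_set D by apply: bounded_subset bV; exact: subDsetl.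
have bQ : bounded_set Q by apply: bounded_subset Qa _; exact: bounded_disc.
have bp : bounded_set p by apply: bounded_subset pb _; exact: bounded_disc.
have Qp : Q `&` p = set0.
  apply/seteqP; split => z //= -[/Qa + /pa]; rewrite /disc /=; lra.
have QD : Q `&` D = set0 by apply/seteqP; split => z //= -[Qz [_ h]]; apply: h; left.
have pD : p `&` D = set0 by apply/seteqP; split => z //= -[Qz [_ h]]; apply: h; right.
have [mE PE] := pair_event_prob mQ mp mD bQ bp bD Qp QD pD.
exists (pair_event Q p D); split => //.
  rewrite PE lee_fin ler_wpM2l // ler_expR lerN2 -mulrA.
  rewrite ler_wpM2l ?(ltW lam0) //.
  (* The three sets cover [V], whose discs have radius above [s - 2 * e - 6 * e]. *)
  apply: (@le_trans _ _ (area V)).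
    rewrite area_two_discs // ler_wpM2l ?(ltW (mnn_area_gt0 R)) //.
    by rewrite dab' ler_sqr ?nnegrE; lra.
  rewrite -!areaU //; [|exact: measurableU|exact: bounded_setU|].
    apply: area_le => //; [|apply: bounded_setU => //; exact: bounded_setU|].
      by apply: measurableU => //; exact: measurableU.
    move=> z Vz; have [h|h] := pselect ((Q `|` p) z); [by left|by right].
  by rewrite setIUl QD pD setU0.
move=> w x y Qx py xy sxy; have [px [py' _]] := xy.
have close c z z' : edist c z <= e -> edist c z' <= e -> edist z z' <= 2 * e.
  by move=> h1 h2; have := edist_triangle z c z'; rewrite (edistC z c); lra.
split.
(* A second atom of [Q] would be within [2 * e] of [x], nearer than the partner. *)
- apply: (@cnt_set1 _ _ _ x); apply/seteqP; split => z /=; last by move=> ->.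
  move=> [pz Qz]; apply: contrapT => zx.
  apply: (mnnr_near xy pz zx).
  by have := close a _ _ (Qa _ Qx) (Qa _ Qz); lra.
- apply: (@cnt_set1 _ _ _ y); apply/seteqP; split => z /=; last by move=> ->.
  move=> [pz pz']; apply: contrapT => zy.
  apply: (mnnr_near (mnnrC xy) pz zy).
  by have := close b _ _ (pb _ py) (pb _ pz'); rewrite (edistC y x); lra.
- apply: cnt_set0; apply/seteqP; split => z //= -[pz [Vz nz]].
  apply: (mnnr_excl xy pz); last exact: (inc x y (Qa _ Qx) (pb _ py)).
    by move=> zx; apply: nz; left; rewrite zx.
  by move=> zy; apply: nz; right; rewrite zy.
Qed.

(** Conversely, one atom in each cell and none in the rest of the enlarged union [V] force the two
    atoms to be partners. *)
Lemma pair_lower (s t e : R) (a b : pt) (Q p : set pt) : 0 < e -> 0 < s ->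
  measurable Q -> measurable p -> Q `<=` disc a e -> p `<=` disc b e ->
  (forall y, p y -> s + e < edist a y <= t - e) ->
  exists E : set Omega, [/\ measurable E,
    ((lam ^+ 2 * area Q * area p * expR (- (lam * mnn_area R * (t + 6 * e) ^+ 2)))%:E <= P E)%E
    & forall w, E w -> exists x y, [/\ Q x, p y & mnnr (Phi w) x y]].
Proof.
move=> e0 s0 mQ mp Qa pb pa.
have w0 : 0 <= lam ^+ 2 * area Q * area p.
  by apply: mulr_ge0; [apply: mulr_ge0|]; rewrite ?area_ge0 ?sqr_ge0.
have [p0|/set0P[y0 py0]] := eqVneq p set0.
  exists set0; split => //.
  by rewrite measure0 p0 /area measure0 /= mulr0 mul0r.
have ab : s < edist a b <= t.
  have := pa _ py0; have := pb _ py0; rewrite /disc /=.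
  have := edist_triangle a b y0; have := edist_triangle a y0 b.
  by rewrite (edistC y0 b); lra.
have [||a' [b' [a'b' dab' inc]]] := @two_discs_outer a b e => //; first by lra.
set V := two_discs a' b'.
pose D := V `\` (Q `|` p).
have mV : measurable V by exact: measurable_two_discs.
have mD : measurable D by apply: measurableD => //; exact: measurableU.
have bV : bounded_set V by exact: bounded_two_discs.
have bD : bounded_set D by apply: bounded_subset bV; exact: subDsetl.
have bQ : bounded_set Q by apply: bounded_subset Qa _; exact: bounded_disc.
have bp : bounded_set p by apply: bounded_subset pb _; exact: bounded_disc.
have Qp : Q `&` p = set0.
  apply/seteqP; split => z //= -[/Qa + /pa]; rewrite /disc /=; lra.
have QD : Q `&` D = set0 by apply/seteqP; split => z //= -[Qz [_ h]]; apply: h; left.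
have pD : p `&` D = set0 by apply/seteqP; split => z //= -[Qz [_ h]]; apply: h; right.
have in1 (x y : pt) : two_discs x y x by left; rewrite /disc /= edistxx edist_ge0.
have in2 (x y : pt) : two_discs x y y by right; rewrite /disc /= edistxx edist_ge0.
have [mE PE] := pair_event_prob mQ mp mD bQ bp bD Qp QD pD.
exists (pair_event Q p D); split => //.
  rewrite PE lee_fin ler_wpM2l // ler_expR lerN2 -mulrA.
  rewrite ler_wpM2l ?(ltW lam0) //.
  apply: (@le_trans _ _ (area V)); last first.
    rewrite area_two_discs // ler_wpM2l ?(ltW (mnn_area_gt0 R)) //.
    by rewrite dab' ler_sqr ?nnegrE; lra.
  (* Both cells lie inside [V], so the total area is at most that of [V]. *)
  rewrite -!areaU //; [|exact: measurableU|exact: bounded_setU|].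
    apply: area_le => //; first by apply: measurableU => //; exact: measurableU.
    move=> z [[Qz|pz]|[]//].
    - by apply: (inc z b); rewrite ?edistxx ?(ltW e0) //; exact: Qa.
    - by apply: (inc a z); rewrite ?edistxx ?(ltW e0) //; exact: pb.
  by rewrite setIUl QD pD setU0.
move=> w [/cnt1P[x [px Qx ux]] /cnt1P[y [py py' uy]] /cnt0P h].
exists x, y; split => //; apply: mnnr_of_excl => //.
  move=> xy; have : (Q `&` p) x by split => //; rewrite xy.
  by rewrite Qp.
move=> z pz zx zy Vz; apply: (h z pz); split.
  exact: (inc x y (Qa _ Qx) (pb _ py')).
by move=> [/(ux _ pz)|/(uy _ pz)].
Qed.

End PairEstimates.

(** * Summing the pair estimates over all cells *)

Section CellSums.
Variable R : realType.
Local Notation pt := (R * R)%type.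

(** Atoms sorted by the distance to their partner; [setT] gives the whole thinned process. *)
Definition mnn_at (phi : set pt) (I : set R) : set pt :=
  [set x | exists2 y, mnnr phi x y & I (edist x y)].

Lemma unit_squareE : @unit_square R = `[0, 1]%classic `*` `[0, 1]%classic.
Proof. by apply/seteqP; split => z; rewrite /unit_square /= !in_itv. Qed.

Lemma measurable_unit_square : measurable (@unit_square R).
Proof. by rewrite unit_squareE; apply: measurableX; exact: measurable_itv. Qed.

Lemma unit_square_edist (z : pt) : @unit_square R z -> edist (0, 0) z <= 2.
Proof.
move=> [/andP[h1 h2] /andP[h3 h4]].
rewrite -[leRHS]ger0_norm // -[leLHS]ger0_norm ?edist_ge0 //.
rewrite -ler_sqr ?nnegrE // !real_normK ?num_real // sqr_edist /= !sub0r !sqrrN.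
have q1 : z.1 ^+ 2 <= 1 by rewrite expr_le1.
have q2 : z.2 ^+ 2 <= 1 by rewrite expr_le1.
have -> : 2 ^+ 2 = 4 :> R by ring.
by lra.
Qed.

Lemma bounded_unit_square : bounded_set (@unit_square R).
Proof. by exists 2 => z; exact: unit_square_edist. Qed.

Lemma area_unit_square : area (@unit_square R) = 1.
Proof.
rewrite /area (_ : leb2 _ = 1%:E) // unit_squareE.
transitivity (lebesgue_measure `[0%R, 1%R]%classic *
  lebesgue_measure `[0%R, 1%R]%classic : \bar R)%E.
  by apply: product_measure1E; exact: measurable_itv.
by rewrite !lebesgue_measure_itv /= lte_fin ltr01 oppr0 adde0 mule1.
Qed.

Context (d : measure_display) (Omega : measurableType d)
  (P : probability Omega R) (Phi : Omega -> set pt) (lam : R).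
Hypotheses (lam0 : 0 < lam) (pPhi : is_poisson_pp P Phi lam).

Definition mnn_count (I : set R) (w : Omega) : \bar R :=
  cnt (mnn_at (Phi w) I) (@unit_square R).

Lemma integral_sum_indic (I : finType) (E : I * I -> set Omega) :
  (forall k, measurable (E k)) ->
  (\int[P]_w (\sum_i \sum_j (\1_(E (i, j)) w)%:E) = \sum_i \sum_j P (E (i, j)))%E.
Proof.
move=> mE.
have m1 i j : measurable_fun setT (fun w => (\1_(E (i, j)) w : R)%:E).
  by apply/measurable_EFinP; exact: measurable_indic.
have n1 i j w : (0 <= (\1_(E (i, j)) w : R)%:E)%E by rewrite lee_fin.
rewrite ge0_integral_sum //; last first.
- by move=> i w _; apply: sume_ge0.
- by move=> i; apply: emeasurable_sum.
apply: eq_bigr => i _; rewrite ge0_integral_sum //; apply: eq_bigr => j _.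
by rewrite integral_indic // setIT.
Qed.

Lemma measurable_sum_indic (I : finType) (E : I * I -> set Omega) :
  (forall k, measurable (E k)) ->
  measurable_fun setT (fun w => \sum_i \sum_j (\1_(E (i, j)) w : R)%:E)%E.
Proof.
move=> mE; apply: emeasurable_sum => i; apply: emeasurable_sum => j.
by apply/measurable_EFinP; exact: measurable_indic.
Qed.

(** Each cell holds at most one counted atom, and then the event of its cell and its partner's cell
    occurs; the sum of these indicators is a measurable majorant. *)
Lemma upper_le_mnn_count_grid (s t e : R) : 0 < e -> 8 * e < s -> s < t ->
  upper_le P (mnn_count `]s, t]%classic)
    (lam ^+ 2 * (pi * ((t + e) ^+ 2 - (s - e) ^+ 2)) *
     expR (- (lam * mnn_area R * (s - 8 * e) ^+ 2))).
Proof.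
move=> e0 es st.
set al := pi * _; set ka := expR _.
(* Points of the unit square have norm at most 2, so the grid contains all partners at distance at
   most [t]. *)
have [I [Q [a [mQ disQ cov Qa]]]] := @fine_partition R (3 + t) e (ltac:(lra)) e0.
pose U := @unit_square R; have mU := measurable_unit_square.
(* Widening by [e] on both sides allows for the distance between an atom and the centre [a i] of its
   cell. *)
pose p i j := annulus (a i) (s - e) (t + e) `&` Q j.
have /choice[E EP] : forall k : I * I, exists E : set Omega, [/\ measurable E,
    (P E <= (lam ^+ 2 * area (U `&` Q k.1) * area (p k.1 k.2) * ka)%:E)%E
    & forall w x y, (U `&` Q k.1) x -> p k.1 k.2 y -> mnnr (Phi w) x y ->
        s < edist x y -> E w].
  move=> [i j] /=; apply: (@pair_upper R _ _ P Phi lam lam0 pPhi s e (a i) (a j)) => //.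
  - exact: measurableI.
  - by apply: measurableI => //; exact: measurable_annulus.
  - by move=> z [_ /Qa].
  - by move=> z [_ /Qa].
  - by move=> y [[_ h] _]; rewrite ltNge; apply/negP.
have mE k : measurable (E k) by have [] := EP k.
have n1 i j w : (0 <= (\1_(E (i, j)) w : R)%:E)%E by rewrite lee_fin.
move=> e' e'0; exists (fun w => \sum_i \sum_j (\1_(E (i, j)) w)%:E)%E; split.
- exact: measurable_sum_indic.
- by move=> w; apply: sume_ge0 => i _; apply: sume_ge0.
- move=> w; rewrite /mnn_count (@cnt_sum_partition _ _ _ _ Q) //; last first.
    by move=> z /unit_square_edist h; apply: cov; lra.
  apply: lee_sum => i _.
  have [/cnt_set0 ->|/set0P[x [[y xy]]]] :=
      eqVneq (mnn_at (Phi w) `]s, t]%classic `&` (@unit_square R `&` Q i)) set0.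
    exact: sume_ge0.
  rewrite /= in_itv /= => /andP[sxy xyt] [Ux Qx].
  have ax := Qa _ _ Qx; rewrite /disc /= in ax.
  rewrite (@cnt_set1 _ _ _ x); last first.
    apply/seteqP; split => z /=; last by move=> ->; split => //; exists y => //=; rewrite in_itv /= sxy.
    move=> [[y' [pz _] _] [_ Qz]]; apply: contrapT => zx.
    have az := Qa _ _ Qz; rewrite /disc /= in az.
    apply: (mnnr_near xy pz zx).
    by have := edist_triangle x (a i) z; rewrite (edistC x (a i)); lra.
  have [j Qj] : exists j, Q j y.
    apply: cov; have := edist_triangle (0, 0) x y.
    by have := unit_square_edist Ux; lra.
  rewrite (bigD1 j) //= indicE mem_set ?leeDl //.
    by apply: sume_ge0.
  have [_ _ h] := EP (i, j); apply: (h w x y) => //=; split => //.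
  have t1 := edist_triangle (a i) x y; have t2 := edist_triangle x (a i) y.
  rewrite (edistC x (a i)) in t2.
  by split; rewrite /disc /=; [lra|apply/negP; rewrite -ltNge; lra].
- rewrite integral_sum_indic //.
  apply: (@le_trans _ _ (\sum_i \sum_j (lam ^+ 2 * area (U `&` Q i) * area (p i j) * ka)%:E)%E).
    by apply: lee_sum => i _; apply: lee_sum => j _; have [] := EP (i, j).
  under eq_bigr do rewrite sumEFin; rewrite sumEFin lee_fin.
  apply: (@le_trans _ _ (lam ^+ 2 * al * ka)); last by lra.
  (* The sum over [j] is bounded by the area of the annulus, the one over [i] by the area 1 of the
     square. *)
  apply: (@le_trans _ _ (\sum_i (area (U `&` Q i) * (lam ^+ 2 * al * ka)))).
    apply: ler_sum => i _.
    rewrite -mulr_suml -mulr_sumr.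
    have -> : area (U `&` Q i) * (lam ^+ 2 * al * ka) = lam ^+ 2 * area (U `&` Q i) * al * ka by ring.
    rewrite ler_wpM2r ?expR_ge0 // ler_wpM2l ?mulr_ge0 ?area_ge0 ?(ltW lam0) //.
    have [h _] := area_partition (measurable_annulus (a i) (s - e) (t + e))
      (bounded_subset (@subDsetl _ _ _) (bounded_disc (a i) (t + e))) mQ disQ.
    apply: le_trans h _; rewrite /area leb2_annulus //; lra.
  rewrite -mulr_suml -[leRHS]mul1r.
  rewrite ler_wpM2r //.
    rewrite !mulr_ge0 ?expR_ge0 ?(ltW lam0) ?pi_ge0 // subr_ge0 ler_sqr ?nnegrE; lra.
  have [h _] := area_partition mU bounded_unit_square mQ disQ.
  by apply: le_trans h _; rewrite area_unit_square.
Qed.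

(** For a fixed first cell at most one of the events occurs, and it produces a counted atom; so the
    indicators form a measurable minorant. *)
Lemma lower_ge_mnn_count_grid (s t e : R) : 0 < e -> 2 * e < s -> s + 2 * e < t ->
  lower_ge P (mnn_count `]s, t]%classic)
    (lam ^+ 2 * (pi * ((t - e) ^+ 2 - (s + e) ^+ 2)) *
     expR (- (lam * mnn_area R * (t + 6 * e) ^+ 2))).
Proof.
move=> e0 es st.
set al := pi * _; set ka := expR _.
have [I [Q [a [mQ disQ cov Qa]]]] := @fine_partition R (3 + t) e (ltac:(lra)) e0.
pose U := @unit_square R; have mU := measurable_unit_square.
pose p i j := annulus (a i) (s + e) (t - e) `&` Q j.
have pE i j y : p i j y -> s + e < edist (a i) y <= t - e.
  by move=> [[h1 h2] _]; apply/andP; split => //; rewrite ltNge; apply/negP.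
have /choice[E EP] : forall k : I * I, exists E : set Omega, [/\ measurable E,
    ((lam ^+ 2 * area (U `&` Q k.1) * area (p k.1 k.2) * ka)%:E <= P E)%E
    & forall w, E w -> exists x y, [/\ (U `&` Q k.1) x, p k.1 k.2 y & mnnr (Phi w) x y]].
  move=> [i j] /=; apply: (@pair_lower R _ _ P Phi lam lam0 pPhi s t e (a i) (a j)) => //.
  - by lra.
  - exact: measurableI.
  - by apply: measurableI => //; exact: measurable_annulus.
  - by move=> z [_ /Qa].
  - by move=> z [_ /Qa].
  - by move=> y; exact: pE.
have mE k : measurable (E k) by have [] := EP k.
have n1 i j w : (0 <= (\1_(E (i, j)) w : R)%:E)%E by rewrite lee_fin.
move=> e' e'0; exists (fun w => \sum_i \sum_j (\1_(E (i, j)) w)%:E)%E; split.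
- exact: measurable_sum_indic.
- by move=> w; apply: sume_ge0 => i _; apply: sume_ge0.
- move=> w; rewrite /mnn_count (@cnt_sum_partition _ _ _ _ Q) //; last first.
    by move=> z /unit_square_edist h; apply: cov; lra.
  apply: lee_sum => i _.
  have [[j Ej]|noE] := pselect (exists j, E (i, j) w); last first.
    rewrite big1 ?cnt_ge0 // => j _; rewrite indicE memNset //.
    by move=> h; apply: noE; exists j.
  have [_ _ /(_ w Ej)[x [y [/= [Ux Qx] pxy xy]]]] := EP (i, j).
  have far x' y' j' : Q i x' -> p i j' y' -> s < edist x' y' <= t.
    move=> /Qa; rewrite /disc /= => ax' /pE hy.
    have t1 := edist_triangle (a i) x' y'; have t2 := edist_triangle x' (a i) y'.
    by rewrite (edistC x' (a i)) in t2; lra.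
  rewrite (bigD1 j) //= big1 ?adde0; last first.
    (* A second event would give the same atom [x], since its cell is too small for two, and hence
       the same partner in two disjoint cells. *)
    move=> j' jj'; rewrite indicE memNset // => Ej'.
    have [_ _ /(_ w Ej')[x' [y' [/= [Ux' Qx'] pxy' xy']]]] := EP (i, j').
    have xx' : x' = x.
      apply: contrapT => nxx'; have [px' _] := xy'.
      apply: (mnnr_near xy px' nxx').
      have := Qa _ _ Qx; have := Qa _ _ Qx'; rewrite /disc /=.
      have := far _ _ _ Qx pxy.
      by have := edist_triangle x (a i) x'; rewrite (edistC x (a i)); lra.
    rewrite xx' in xy'; have yy' := mnnr_uniq xy xy'.
    have : (Q j' `&` Q j) y by split; [rewrite yy'; case: pxy'|case: pxy].
    by rewrite disQ.
  rewrite indicE mem_set //; apply: (@cnt_ge1 _ _ _ x) => //.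
  by exists y => //=; rewrite in_itv /=; exact: far Qx pxy.
- rewrite integral_sum_indic //.
  apply: (@le_trans _ _ (\sum_i \sum_j (lam ^+ 2 * area (U `&` Q i) * area (p i j) * ka)%:E)%E); last first.
    by apply: lee_sum => i _; apply: lee_sum => j _; have [] := EP (i, j).
  under eq_bigr do rewrite sumEFin; rewrite sumEFin lee_fin.
  apply: (@le_trans _ _ (lam ^+ 2 * al * ka)); first by lra.
  apply: (@le_trans _ _ (\sum_i (area (U `&` Q i) * (lam ^+ 2 * al * ka)))).
    rewrite -mulr_suml.
    have [_ ->] := area_partition mU bounded_unit_square mQ disQ.
      by rewrite area_unit_square mul1r.
    by move=> z /unit_square_edist h; apply: cov; lra.
  apply: ler_sum => i _.
  rewrite -mulr_suml -mulr_sumr.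
  have -> : area (U `&` Q i) * (lam ^+ 2 * al * ka) = lam ^+ 2 * area (U `&` Q i) * al * ka by ring.
  (* A cell meeting the square has its centre close to it, so the grid covers the annulus; other
     cells contribute 0 to both sides. *)
  have [->|/set0P[x [Ux Qx]]] := eqVneq (U `&` Q i) set0.
    by rewrite /area measure0 /= !(mulr0, mul0r).
  rewrite ler_wpM2r ?expR_ge0 // ler_wpM2l ?mulr_ge0 ?area_ge0 ?(ltW lam0) //.
  have [_ ->] := area_partition (measurable_annulus (a i) (s + e) (t - e))
      (bounded_subset (@subDsetl _ _ _) (bounded_disc (a i) (t - e))) mQ disQ.
    rewrite /area leb2_annulus //; lra.
  move=> z [az _]; rewrite /disc /= in az; apply: cov.
  have := edist_triangle (0, 0) x z; have := edist_triangle x (a i) z.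
  rewrite (edistC x (a i)); have := unit_square_edist Ux.
  by have := Qa _ _ Qx; rewrite /disc /=; lra.
Qed.

End CellSums.

(** * Mean counts of mutually nearest atoms *)

Section ExactIntegrals.
Variable R : realType.
Local Notation pt := (R * R)%type.

(** Provides an admissible mesh at which a grid bound is close to its limit. *)
Lemma continuous_at0_small (F : R -> R) (K e : R) : {for 0, continuous F} ->
  0 < K -> 0 < e -> exists2 x, 0 < x < K & `|F 0 - F x| < e.
Proof.
move=> /cvgrPdist_lt/(_ e) H K0 e0.
have := H e0; rewrite near_nbhs => -[r /= r0 Hr].
exists (Num.min r K / 2).
  have m0 : 0 < Num.min r K by rewrite lt_min r0 K0.
  have : Num.min r K <= K by rewrite ge_min lexx orbT.
  by lra.
apply: Hr => /=; have m0 : 0 < Num.min r K by rewrite lt_min r0 K0.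
have mr : Num.min r K <= r by rewrite ge_min lexx.
by rewrite sub0r normrN gtr0_norm; lra.
Qed.

Lemma continuous_affine_sqr (p k : R) : continuous (fun e : R => (p + k * e) ^+ 2).
Proof.
move=> x; apply: (@continuous_comp _ _ _ (fun e => p + k * e) (fun y => y ^+ 2)).
  apply: cvgD; first exact: cvg_cst.
  by apply: cvgM; [exact: cvg_cst|exact: cvg_id].
exact: exprn_continuous.
Qed.

Lemma continuous_gauss (k p q : R) :
  continuous (fun e : R => expR (- (k * (p + q * e) ^+ 2))).
Proof.
move=> x; apply: (@continuous_comp _ _ _ (fun e => - (k * (p + q * e) ^+ 2)) (@expR R)).
  by apply: cvgN; apply: cvgM; [exact: cvg_cst|exact: continuous_affine_sqr].
exact: continuous_expR.
Qed.

(** From [expR x >= 1 + x] and [(1 - x + x ^+ 2) * (1 + x) = 1 + x ^+ 3 >= 1]. *)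
Lemma expRN_le (x : R) : 0 <= x -> expR (- x) <= 1 - x + x ^+ 2.
Proof.
move=> x0; have e1 := expR_ge1Dx x; have p1 : 0 < 1 + x by lra.
rewrite expRN; apply: (@le_trans _ _ (1 + x)^-1); first by rewrite lef_pV2 ?posrE ?expR_gt0.
rewrite -(ler_pM2r p1) mulVf ?gt_eqF //.
have -> : (1 - x + x ^+ 2) * (1 + x) = 1 + x ^+ 3 by ring.
by have := exprn_ge0 3 x0; lra.
Qed.

(** To be read with [y] an exponential at the start of a step and [y * e] at its end: rate times
    step exceeds the decrement only to second order. *)
Lemma exp_step_upper (A y x e : R) : 0 < y -> y <= A -> e <= 1 - x + x ^+ 2 ->
  y * x <= y - y * e + A * x ^+ 2.
Proof.
move=> y0 yA ex; have h1 := ler_wpM2l (ltW y0) ex.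
by have h2 := ler_wpM2r (sqr_ge0 x) yA; lra.
Qed.

Lemma exp_step_lower (A y x e : R) : 0 < y -> y <= A -> 0 <= x -> 1 + - x <= e ->
  y - y * e - A * x ^+ 2 <= y * e * x.
Proof.
move=> y0 yA x0 ex; have y1 : 0 <= y * (1 + x) by rewrite mulr_ge0 ?ltW //; lra.
have h1 := ler_wpM2l y1 ex.
by have h2 := ler_wpM2r (sqr_ge0 x) yA; lra.
Qed.

Context (d : measure_display) (Omega : measurableType d)
  (P : probability Omega R) (Phi : Omega -> set pt) (lam : R).
Hypotheses (lam0 : 0 < lam) (pPhi : is_poisson_pp P Phi lam).

Let c := mnn_area R.
Let c0 : 0 < c := mnn_area_gt0 R.
Local Notation N := (mnn_count Phi).

(** The grid bound is continuous in the mesh [e], which tends to 0 below [s / 8]. *)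
Lemma upper_le_mnn_count_oc (s t : R) : 0 < s -> s < t ->
  upper_le P (N `]s, t]%classic)
    (lam ^+ 2 * (pi * (t ^+ 2 - s ^+ 2)) * expR (- (lam * c * s ^+ 2))).
Proof.
move=> s0 st; apply: upper_le_closed => e' e'0.
pose F e := lam ^+ 2 * (pi * ((t + 1 * e) ^+ 2 - (s + - 1 * e) ^+ 2)) *
     expR (- (lam * c * (s + - 8 * e) ^+ 2)).
have cF : {for 0, continuous F}.
  apply: cvgM; first apply: cvgM; first exact: cvg_cst.
    apply: cvgM; first exact: cvg_cst.
    by apply: cvgB; exact: continuous_affine_sqr.
  exact: continuous_gauss.
have [e /andP[e0 es] Fe] := continuous_at0_small cF (divr_gt0 s0 (ltr0n R 8)) e'0.
exists (F e).
  by rewrite /F mul1r mulN1r mulNr; apply: upper_le_mnn_count_grid => //; lra.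
have F0 : F 0 = lam ^+ 2 * (pi * (t ^+ 2 - s ^+ 2)) * expR (- (lam * c * s ^+ 2)).
  by rewrite /F !mulr0 !addr0.
by rewrite -F0; move: Fe; rewrite ltr_norml; lra.
Qed.

Lemma lower_ge_mnn_count_oc (s t : R) : 0 < s -> s < t ->
  lower_ge P (N `]s, t]%classic)
    (lam ^+ 2 * (pi * (t ^+ 2 - s ^+ 2)) * expR (- (lam * c * t ^+ 2))).
Proof.
move=> s0 st; apply: lower_ge_closed => e' e'0.
pose F e := lam ^+ 2 * (pi * ((t + - 1 * e) ^+ 2 - (s + 1 * e) ^+ 2)) *
     expR (- (lam * c * (t + 6 * e) ^+ 2)).
have cF : {for 0, continuous F}.
  apply: cvgM; first apply: cvgM; first exact: cvg_cst.
    apply: cvgM; first exact: cvg_cst.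
    by apply: cvgB; exact: continuous_affine_sqr.
  exact: continuous_gauss.
have K0 : 0 < Num.min (s / 2) ((t - s) / 2) by rewrite lt_min; apply/andP; split; lra.
have [e /andP[e0 eK] Fe] := continuous_at0_small cF K0 e'0.
move: eK; rewrite lt_min => /andP[eK1 eK2].
exists (F e).
  by rewrite /F mul1r mulN1r; apply: lower_ge_mnn_count_grid => //; lra.
have F0 : F 0 = lam ^+ 2 * (pi * (t ^+ 2 - s ^+ 2)) * expR (- (lam * c * t ^+ 2)).
  by rewrite /F !mulr0 !addr0.
by rewrite -F0; move: Fe; rewrite ltr_norml; lra.
Qed.

(* The squared distance is the coordinate in which the mean count is exponential. *)
Definition sqr_oc (u v : R) : set R := [set x | u < x ^+ 2 <= v].

Lemma mnn_count_sqr_oc (u v : R) w : 0 <= u -> 0 <= v ->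
  N (sqr_oc u v) w = N `]Num.sqrt u, Num.sqrt v]%classic w.
Proof.
move=> u0 v0; congr cnt; apply/seteqP; split => x [y xy h]; exists y => //.
all: move: h; rewrite /sqr_oc /= in_itv /= => /andP[h1 h2].
all: have e0 := edist_ge0 x y.
- rewrite -[edist x y](ger0_norm e0) -sqrtr_sqr ltr_sqrt ?ler_wsqrtr ?h1 //.
  exact: le_lt_trans h1.
- rewrite -[X in X < _](sqr_sqrtr u0) -[X in _ <= X](sqr_sqrtr v0).
  by rewrite ltr_sqr ?ler_sqr ?nnegrE ?sqrtr_ge0 // h1.
Qed.

(** Uniqueness of the partner gives each atom a single distance, so disjoint sets of distances
    select disjoint atoms. *)
Lemma mnn_countU (I J : set R) w : I `&` J = set0 ->
  N (I `|` J) w = (N I w + N J w)%E.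
Proof.
move=> IJ; rewrite /mnn_count -cntU.
  congr cnt; apply/seteqP; split => x.
    by move=> [y xy [h|h]]; [left|right]; exists y.
  by move=> [[y xy h]|[y xy h]]; exists y => //; [left|right].
apply/seteqP; split => x //= -[[y xy h] [z xz h']].
rewrite -(mnnr_uniq xy xz) in h'.
by have : (I `&` J) (edist x y) by []; rewrite IJ.
Qed.

Lemma mnn_count_bigcup (I : nat -> set R) w : trivIset setT I ->
  N (\bigcup_k I k) w = (\sum_(0 <= k <oo) N (I k) w)%E.
Proof.
move=> tI; rewrite /mnn_count -cnt_bigcup.
  congr cnt; apply/seteqP; split => x.
    by move=> [y xy [k _ h]]; exists k => //; exists y.
  by move=> [k _ [y xy h]]; exists y => //; exists k.
apply/trivIsetP => i j _ _ ij; apply/seteqP; split => x //= -[[y xy h] [z xz h']].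
rewrite -(mnnr_uniq xy xz) in h'.
move/trivIsetP : tI => /(_ i j Logic.I Logic.I ij) tI.
by have : (I i `&` I j) (edist x y) by []; rewrite tI.
Qed.

Lemma mnn_count_le (I J : set R) w : I `<=` J -> (N I w <= N J w)%E.
Proof. by move=> IJ; apply: cnt_le => x [y xy h]; exists y => //; exact: IJ. Qed.

(** [A] will be the mean number of thinned atoms in the unit square, and [h u] that of those whose
    squared partner distance exceeds [u]. *)
Let A := lam * pi / c.
Let h (u : R) := A * expR (- (lam * c * u)).

Let A0 : 0 < A.
Proof. by rewrite /A !(mulr_gt0, invr_gt0, pi_gt0). Qed.

Let K := A * (lam * c) ^+ 2.

Let rateE (u v : R) : lam ^+ 2 * (pi * (v - u)) = A * (lam * c * (v - u)).
Proof. by rewrite /A; field; rewrite gt_eqF. Qed.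

Let hD (u v : R) : h v = h u * expR (- (lam * c * (v - u))).
Proof. by rewrite /h -[RHS]mulrA -expRD; congr (_ * expR _); ring. Qed.

Let h_gt0 u : 0 < h u.
Proof. by rewrite /h mulr_gt0 // expR_gt0. Qed.

Let h_le u : 0 <= u -> h u <= A.
Proof.
move=> u0; rewrite /h -[leRHS]mulr1 ler_wpM2l ?(ltW A0) // -expR0 ler_expR.
by rewrite oppr_le0 mulr_ge0 // mulr_ge0 // ltW.
Qed.

(** With [x = lam * c * (v - u)] the bound for one interval is [h u * x], to be compared with
    [h u * (1 - expR (- x))]. *)
Lemma upper_le_step (u v : R) : 0 < u -> u < v ->
  upper_le P (N (sqr_oc u v)) (h u - h v + K * (v - u) ^+ 2).
Proof.
move=> u0 uv; have v0 : 0 < v by exact: lt_trans uv.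
have su : 0 < Num.sqrt u by rewrite sqrtr_gt0.
have suv : Num.sqrt u < Num.sqrt v by rewrite ltr_sqrt.
apply: upper_leW (upper_le_mnn_count_oc su suv).
- by move=> w; rewrite mnn_count_sqr_oc // ltW.
- rewrite !sqr_sqrtr ?(ltW u0) ?(ltW v0) // rateE.
  have x0 : 0 <= lam * c * (v - u) by rewrite mulr_ge0 ?mulr_ge0 ?subr_ge0 ?ltW.
  have -> : A * (lam * c * (v - u)) * expR (- (lam * c * u)) =
    h u * (lam * c * (v - u)) by rewrite /h; ring.
  have -> : K * (v - u) ^+ 2 = A * (lam * c * (v - u)) ^+ 2 by rewrite /K; ring.
  rewrite (hD u v); set x := lam * c * (v - u) in x0 *.
  exact: (exp_step_upper (h_gt0 u) (h_le (ltW u0)) (expRN_le x0)).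
Qed.

Lemma lower_ge_step (u v : R) : 0 < u -> u < v ->
  lower_ge P (N (sqr_oc u v)) (h u - h v - K * (v - u) ^+ 2).
Proof.
move=> u0 uv; have v0 : 0 < v by exact: lt_trans uv.
have su : 0 < Num.sqrt u by rewrite sqrtr_gt0.
have suv : Num.sqrt u < Num.sqrt v by rewrite ltr_sqrt.
apply: lower_geW (lower_ge_mnn_count_oc su suv).
- by move=> w; rewrite mnn_count_sqr_oc // ltW.
- rewrite !sqr_sqrtr ?(ltW u0) ?(ltW v0) // rateE.
  have x0 : 0 <= lam * c * (v - u) by rewrite mulr_ge0 ?mulr_ge0 ?subr_ge0 ?ltW.
  have -> : A * (lam * c * (v - u)) * expR (- (lam * c * v)) =
    h v * (lam * c * (v - u)) by rewrite /h; ring.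
  have -> : K * (v - u) ^+ 2 = A * (lam * c * (v - u)) ^+ 2 by rewrite /K; ring.
  rewrite (hD u v); set x := lam * c * (v - u) in x0 *.
  exact: (exp_step_lower (h_gt0 u) (h_le (ltW u0)) x0 (expR_ge1Dx (- x))).
Qed.

Lemma sqr_oc_split (u m v : R) : u <= m -> m <= v ->
  sqr_oc u v = sqr_oc u m `|` sqr_oc m v.
Proof.
move=> um mv; apply/seteqP; split => x; rewrite /sqr_oc /=.
  by move=> /andP[h1 h2]; have [h3|h3] := leP (x ^+ 2) m; [left|right]; apply/andP.
by move=> [|] /andP[h1 h2]; apply/andP; split; lra.
Qed.

Lemma sqr_oc_disjoint (u m m' v : R) : m <= m' -> sqr_oc u m `&` sqr_oc m' v = set0.
Proof.
by move=> mm; apply/seteqP; split => x //= -[/andP[_ h1] /andP[h2 _]]; lra.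
Qed.

Lemma mnn_count_split (u m v : R) w : u <= m -> m <= v ->
  N (sqr_oc u v) w = (N (sqr_oc u m) w + N (sqr_oc m v) w)%E.
Proof. by move=> um mv; rewrite (sqr_oc_split um mv) mnn_countU // sqr_oc_disjoint. Qed.

(** The main terms telescope and the [n.+1] quadratic errors add up. *)
Lemma upper_le_steps (n : nat) (u dl : R) : 0 < u -> 0 < dl ->
  upper_le P (N (sqr_oc u (u + n.+1%:R * dl)))
    (h u - h (u + n.+1%:R * dl) + n.+1%:R * (K * dl ^+ 2)).
Proof.
move=> u0 dl0; elim: n => [|n IH].
  rewrite !mul1r; have ud : u < u + dl by lra.
  by have := upper_le_step u0 ud; rewrite (_ : u + dl - u = dl) //; ring.
have nd : 0 <= n.+1%:R * dl by rewrite mulr_ge0 // ltW.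
set m := u + n.+1%:R * dl in IH *.
have E : u + n.+2%:R * dl = m + dl by rewrite /m -[in LHS]natr1; ring.
have m0 : 0 < m by rewrite /m; lra.
have md : m < m + dl by lra.
rewrite E; apply: upper_leW (upper_leD IH (upper_le_step m0 md)).
  by move=> w; rewrite (@mnn_count_split u m (m + dl)) // /m; lra.
by rewrite -[n.+2%:R]natr1 [m + dl - m](_ : _ = dl); [lra|ring].
Qed.

Lemma lower_ge_steps (n : nat) (u dl : R) : 0 < u -> 0 < dl ->
  lower_ge P (N (sqr_oc u (u + n.+1%:R * dl)))
    (h u - h (u + n.+1%:R * dl) - n.+1%:R * (K * dl ^+ 2)).
Proof.
move=> u0 dl0; elim: n => [|n IH].
  rewrite !mul1r; have ud : u < u + dl by lra.
  by have := lower_ge_step u0 ud; rewrite (_ : u + dl - u = dl) //; ring.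
have nd : 0 <= n.+1%:R * dl by rewrite mulr_ge0 // ltW.
set m := u + n.+1%:R * dl in IH *.
have E : u + n.+2%:R * dl = m + dl by rewrite /m -[in LHS]natr1; ring.
have m0 : 0 < m by rewrite /m; lra.
have md : m < m + dl by lra.
rewrite E; apply: lower_geW (lower_geD IH (lower_ge_step m0 md)).
  by move=> w; rewrite (@mnn_count_split u m (m + dl)) // /m; lra.
by rewrite -[n.+2%:R]natr1 [m + dl - m](_ : _ = dl); [lra|ring].
Qed.

(** With [n.+1] equal steps the total error is [K * (v - u) ^+ 2 / n.+1%:R]. *)
Let small_steps (u v e : R) : u < v -> 0 < e -> exists n (dl : R),
  [/\ 0 < dl, v = u + n.+1%:R * dl & n.+1%:R * (K * dl ^+ 2) <= e].
Proof.
move=> uv e0; pose n := Num.truncn (K * (v - u) ^+ 2 / e); pose dl := (v - u) / n.+1%:R.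
have n0 : n.+1%:R != 0 :> R by rewrite pnatr_eq0.
exists n, dl; split.
- by rewrite divr_gt0 ?subr_gt0.
- by rewrite /dl mulrC divfK // addrC subrK.
- have -> : n.+1%:R * (K * dl ^+ 2) = K * (v - u) ^+ 2 / n.+1%:R by rewrite /dl; field.
  rewrite ler_pdivrMr // [leRHS]mulrC -ler_pdivrMr //.
  by rewrite ltW // truncnS_gt.
Qed.

Lemma upper_le_sqr_oc (u v : R) : 0 < u -> u < v ->
  upper_le P (N (sqr_oc u v)) (h u - h v).
Proof.
move=> u0 uv; apply: upper_le_closed => e e0.
have [n [dl [dl0 -> en]]] := small_steps uv e0.
by eexists; [exact: upper_le_steps|rewrite lerD2l].
Qed.

Lemma lower_ge_sqr_oc (u v : R) : 0 < u -> u < v ->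
  lower_ge P (N (sqr_oc u v)) (h u - h v).
Proof.
move=> u0 uv; apply: lower_ge_closed => e e0.
have [n [dl [dl0 -> en]]] := small_steps uv e0.
by eexists; [exact: lower_ge_steps|rewrite lerD2l lerN2].
Qed.

Let h_anti (u v : R) : u <= v -> h v <= h u.
Proof.
move=> uv; rewrite /h ler_wpM2l ?(ltW A0) // ler_expR lerN2 ler_wpM2l //.
by rewrite mulr_ge0 // ltW.
Qed.

Lemma upper_le_sqr_0c (v : R) : 0 < v -> upper_le P (N (sqr_oc 0 v)) (A - h v).
Proof.
(* The bounds so far ask for a positive left end, so the interval is exhausted by pieces with end
   points decreasing to 0. *)
move=> v0; pose b (k : nat) := v / k.+1%:R.
have b0 k : 0 < b k by rewrite divr_gt0.
have bS k : b k.+1 < b k by rewrite /b ltr_pM2l // ltf_pV2 ?posrE // ltr_nat.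
have bmono k l : (k <= l)%N -> b l <= b k.
  by move=> kl; rewrite /b ler_pM2l // lef_pV2 ?posrE // ler_nat.
pose J k := sqr_oc (b k.+1) (b k).
have tJ : trivIset setT J.
  apply/trivIsetP => i j _ _; rewrite neq_ltn => /orP[] ij; last rewrite setIC.
    by rewrite setIC sqr_oc_disjoint // bmono.
  by rewrite setIC sqr_oc_disjoint // bmono.
have JE : sqr_oc 0 v = \bigcup_k J k.
  apply/seteqP; split => x.
    rewrite /sqr_oc /= => /andP[h1 h2].
    (* The integer part of [v / x ^+ 2] is [n.+1] for the piece [J n] that contains [x]. *)
    have /andP[n1 n2] := truncn_itv (divr_ge0 (ltW v0) (ltW h1)).
    have n0 : (0 < Num.truncn (v / x ^+ 2))%N by rewrite truncn_gt0 ler_pdivlMr // mul1r.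
    move: n1 n2 n0; case: (Num.truncn _) => // n n1 n2 _.
    exists n => //; rewrite /J /sqr_oc /b /=; apply/andP; split.
      by rewrite ltr_pdivrMr // mulrC -ltr_pdivrMr.
    by rewrite ler_pdivlMr // mulrC -ler_pdivlMr.
  move=> [k _ /andP[h1 h2]]; apply/andP; split; first exact: lt_trans h1.
  by apply: le_trans h2 _; rewrite -[leRHS]divr1 -[1]/(1%:R) (bmono 0%N).
rewrite JE; apply: upper_leW (lexx _) (@upper_le_series R _ _ P (fun k => N (J k))
  (fun k => h (b k.+1) - h (b k)) (A - h v) _ _ _ _).
- by move=> w; rewrite mnn_count_bigcup.
- by move=> k; rewrite subr_ge0 h_anti // ltW.
- by move=> n; rewrite telescope_sumr // /b divr1 lerB // h_le // divr_ge0 // ltW.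
- by move=> k w; exact: cnt_ge0.
- by move=> k; exact: upper_le_sqr_oc.
Qed.

Lemma upper_le_sqr_oy (v : R) : 0 < v ->
  upper_le P (N [set x | v < x ^+ 2]) (h v).
Proof.
(* Unit steps to infinity; the partial sums telescope to [h v - h (b n)]. *)
move=> v0; pose b (k : nat) := v + k%:R.
have b0 k : 0 < b k by rewrite /b ltr_wpDr.
have bS k : b k < b k.+1 by rewrite /b ltrD2l ltr_nat.
have bmono k l : (k <= l)%N -> b k <= b l by move=> kl; rewrite /b lerD2l ler_nat.
pose J k := sqr_oc (b k) (b k.+1).
have tJ : trivIset setT J.
  apply/trivIsetP => i j _ _; rewrite neq_ltn => /orP[] ij; last rewrite setIC.
    by rewrite sqr_oc_disjoint // bmono.
  by rewrite sqr_oc_disjoint // bmono.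
have JE : [set x : R | v < x ^+ 2] = \bigcup_k J k.
  apply/seteqP; split => x /=; last first.
    by move=> [k _ /andP[h1 h2]]; apply: le_lt_trans h1; rewrite /b lerDl.
  move=> vx; have ex : exists n, x ^+ 2 <= b n.
    exists (Num.truncn (x ^+ 2)).+1; rewrite /b.
    by have := truncnS_gt (x ^+ 2); lra.
  case: (ex_minnP ex) => -[|n] h1 h2.
    by move: h1; rewrite /b addr0 leNgt vx.
  exists n => //; apply/andP; split => //.
  by rewrite ltNge; apply/negP => /h2; rewrite ltnn.
rewrite JE; apply: upper_leW (lexx _) (@upper_le_series R _ _ P (fun k => N (J k))
  (fun k => h (b k) - h (b k.+1)) (h v) _ _ _ _).
- by move=> w; rewrite mnn_count_bigcup.
- by move=> k; rewrite subr_ge0 h_anti // ltW.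
- move=> n; under eq_bigr do rewrite -opprB; rewrite sumrN telescope_sumr //.
  by rewrite opprB /b addr0 gerBl ltW.
- by move=> k w; exact: cnt_ge0.
- by move=> k; exact: upper_le_sqr_oc.
Qed.

Lemma lower_ge_sqr_0c (v : R) : 0 < v -> lower_ge P (N (sqr_oc 0 v)) (A - h v).
Proof.
move=> v0; apply: lower_ge_closed => e e0.
have lc0 : 0 < A * (lam * c) by apply: mulr_gt0 => //; exact: mulr_gt0.
(* Cutting off distances below [u] costs [A - h u <= A * (lam * c) * u <= e]. *)
pose u := Num.min (v / 2) (e / (A * (lam * c))).
have u0 : 0 < u by rewrite lt_min; apply/andP; split; exact: divr_gt0.
have uv : u < v by rewrite gt_min; apply/orP; left; lra.
have ue : A * (lam * c) * u <= e.
  by rewrite mulrC -ler_pdivlMr // ge_min lexx orbT.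
exists (h u - h v).
  apply: lower_geW (lexx _) (lower_ge_sqr_oc u0 uv) => w; apply: mnn_count_le => x.
  by move=> /andP[h1 h2]; apply/andP; split => //; exact: lt_trans h1.
have : A - A * (lam * c) * u <= h u.
  have -> : A - A * (lam * c) * u = A * (1 + - (lam * c * u)) by ring.
  by rewrite /h ler_wpM2l ?(ltW A0) // expR_ge1Dx.
by lra.
Qed.

Lemma lower_ge_total : lower_ge P (N setT) A.
Proof.
apply: lower_ge_closed => e e0.
have lc0 : 0 < lam * c by rewrite mulr_gt0.
(* Chosen so that [lam * c * v = A / e]; then [h v <= e] because [expR y >= y]. *)
pose v := A / (e * (lam * c)).
have v0 : 0 < v by rewrite divr_gt0 // mulr_gt0.
exists (A - h v); first by apply: lower_geW (lexx _) (lower_ge_sqr_0c v0) => w; exact: mnn_count_le.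
have lcv : lam * c * v = A / e by rewrite /v; field; rewrite !gt_eqF.
rewrite lerD2l lerN2 /h lcv expRN ler_pdivrMr ?expR_gt0 //.
rewrite mulrC -ler_pdivrMr //; apply: le_trans (expR_ge1Dx _); lra.
Qed.

Lemma mean_mnn_count_le (r : R) : 0 < r ->
  (\int[P]_w N (sqr_oc 0 (r ^+ 2)) w = (A - A * expR (- (lam * c * r ^+ 2)))%:E)%E.
Proof.
move=> r0; have r2 : 0 < r ^+ 2 by rewrite exprn_gt0.
apply/eqP; rewrite eq_le; apply/andP; split.
  by apply: upper_le_integral (upper_le_sqr_0c r2) => w; exact: cnt_ge0.
exact: lower_ge_integral (lower_ge_sqr_0c r2).
Qed.

Lemma mnn_count_total w : N setT w = (N (sqr_oc 0 1) w + N [set x : R | 1 < x ^+ 2]%R w)%E.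
Proof.
rewrite -mnn_countU; last first.
  by apply/seteqP; split => x //= -[/andP[_ h1] h2]; lra.
congr cnt; apply/seteqP; split => x [y xy _]; exists y => //.
(* Partners are distinct, so the distance 0 missing from [sqr_oc 0 1] does not occur. *)
have y0 : 0 < edist x y ^+ 2 by rewrite exprn_gt0 // edist_gt0 //; exact/nesym/(mnnr_neq xy).
by have [h1|h1] := leP (edist x y ^+ 2) 1; [left; apply/andP|right].
Qed.

Lemma mean_mnn_count_total : (\int[P]_w N setT w = A%:E)%E.
Proof.
apply/eqP; rewrite eq_le; apply/andP; split; last exact: lower_ge_integral lower_ge_total.
apply: upper_le_integral => [w|]; first exact: cnt_ge0.
apply: upper_leW (upper_leD (upper_le_sqr_0c ltr01) (upper_le_sqr_oy ltr01)).
  by move=> w; rewrite mnn_count_total.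
by rewrite subrK.
Qed.

End ExactIntegrals.

(** * The Palm event *)

Section PalmEvent.
Variable R : realType.
Local Notation pt := (R * R)%type.

Lemma thin2E (phi : set pt) : thin2 phi = mnn_at phi setT.
Proof.
apply/seteqP; split => x; first by move=> [_ [y [_ xy]]]; exists y.
by move=> [y xy _]; split; [case: xy|exists y; split => //; exact: mnnr_neq xy].
Qed.

Lemma edist_padd_psub (x y z : pt) : edist x (padd z (psub x y)) = edist y z.
Proof. by rewrite /edist /padd /psub /=; congr Num.sqrt; ring. Qed.

(** The partner [z] of [y] survives the thinning and no other atom is nearer to [y]; the shift takes
    [y] to [x] and keeps distances. *)
Lemma dist_set_thin2_shift (phi : set pt) (x y z : pt) : mnnr phi y z ->
  dist_set x (shift (thin2 phi) (psub x y) `\ x) = (edist y z)%:E.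
Proof.
move=> yz; have zy := mnnr_neq yz; apply/eqP; rewrite eq_le; apply/andP; split.
  apply: ereal_inf_lbound; exists (padd z (psub x y)); last by rewrite edist_padd_psub.
  split.
    exists z => //; rewrite thin2E; exists y => //; exact: mnnrC.
  move=> /= E; have := edist_padd_psub x y z; rewrite E edistxx => /esym e0.
  by have := edist_gt0 (nesym zy); rewrite e0 ltxx.
apply: le_ereal_inf_tmp => _ [_ [[z' [pz' _] <-] z'x] <-].
rewrite edist_padd_psub lee_fin leNgt; apply/negP => h.
apply: (mnnr_near yz pz' _ h) => z'y; apply: z'x => /=.
by rewrite z'y /padd /psub [RHS]surjective_pairing; congr (_, _) => /=; ring.
Qed.

Lemma palm_event_mnn_at (phi : set pt) (x : pt) (r : R) : 0 <= r ->
  [set y | thin2 phi y /\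
     (dist_set x (shift (thin2 phi) (psub x y) `\ x) <= r%:E)%E] =
  mnn_at phi (sqr_oc 0 (r ^+ 2)).
Proof.
move=> r0; apply/seteqP; split => y /=.
  rewrite {1}thin2E => -[[z yz _]]; rewrite (dist_set_thin2_shift _ yz) lee_fin => yzr.
  exists z => //; rewrite /sqr_oc /= exprn_gt0 ?edist_gt0 ?ler_sqr ?nnegrE ?edist_ge0 //.
  exact/nesym/(mnnr_neq yz).
move=> [z yz /andP[_]]; rewrite ler_sqr ?nnegrE ?edist_ge0 // => yzr.
split; first by rewrite thin2E; exists z.
by rewrite (dist_set_thin2_shift _ yz) lee_fin.
Qed.

End PalmEvent.

(** * The nearest neighbour distribution as a ratio of two mean counts *)

Theorem theorem2 (R : realType) (d : measure_display) (Omega : measurableType d)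
  (P : probability Omega R) (Phi : Omega -> set (R * R)) (lam : R) :
  0 < lam -> is_poisson_pp P Phi lam ->
  forall (x : R * R) (r : R), 0 <= r ->
    palm P (fun w => thin2 (Phi w)) x
      (fun psi => (dist_set x (psi `\ x) <= r%:E)%E)
    = 1 - expR (- (lam * pi * r ^+ 2 * (2 - gamma_mnn R))).
Proof.
move=> lam0 pPhi x r r0; rewrite /palm.
under eq_integral do rewrite palm_event_mnn_at //.
under [X in _ / fine X]eq_integral do rewrite thin2E.
rewrite (mean_mnn_count_total lam0 pPhi).
(* At radius 0 the set of admissible distances is empty and both sides vanish. *)
have [->|rN0] := eqVneq r 0.
  rewrite integral0_eq; last first.
    move=> w _; apply: cnt_set0; apply/seteqP; split => y //.
    by move=> [[z _ /andP[h1 h2]] _]; move: (lt_le_trans h1 h2); rewrite expr0n ltxx.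
  by rewrite /= mul0r expr0n /= mulr0 mul0r oppr0 expR0 subrr.
have rp : 0 < r by rewrite lt_def rN0.
rewrite (mean_mnn_count_le lam0 pPhi rp) /=.
set A := lam * pi / mnn_area R.
have A0 : A != 0.
  by rewrite gt_eqF // divr_gt0 ?mnn_area_gt0 // mulr_gt0 ?pi_gt0.
rewrite -{1}[A]mulr1 -mulrBr mulrC mulKf //; congr (1 - expR (- _)).
by rewrite mnn_areaE; ring.
Qed.
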